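(* There exists a countably infinite family of pairwise non-isometric special Lagrangian cones in $\mathbb{C}^3$, such that the link $C\cap S^5(1)$ of each cone $C$ in the family is an embedded $2$-torus in $S^5(1)$ which is invariant under some circle subgroup $S^1\subset \mathrm{SU}(3)$.
   Context: $S^5(1)$ is the unit sphere in $\mathbb{C}^3$. For a compact connected oriented embedded submanifold $\Sigma\subset S^5(1)$, the cone on $\Sigma$ is $C(\Sigma)=\{tx:t\ge0,\ x\in\Sigma\}$, and $\Sigma$ is called its link. A cone $C(\Sigma)$ with $\dim\Sigma=2$ is special Lagrangian if $C(\Sigma)\setminus\{0\}$, suitably oriented, is calibrated by $\operatorname{Re}(dz^1\wedge dz^2\wedge dz^3)$, i.e. this form restricts to its Riemannian volume form. *)

(* Defs.v *)
(* MathComp / MathComp-Analysis *)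
From HB Require Import structures.
From mathcomp Require Import all_boot all_order all_algebra.
From mathcomp Require Import all_classical all_reals all_analysis.
From mathcomp Require Import complex.

Set Implicit Arguments.
Unset Strict Implicit.
Unset Printing Implicit Defensive.

Import Order.TTheory GRing.Theory Num.Theory.
Import numFieldNormedType.Exports.

Local Open Scope classical_set_scope.
Local Open Scope ring_scope.
Local Open Scope complex_scope.

(* Submanifolds of Euclidean space are plain subsets of 'rV[R]_n, and
   smoothness on a subset means local smooth extendability, as in Milnor,
   "Topology from the Differentiable Viewpoint". The normed structure of
   'rV[R]_n is the sup norm; it is only used for its topology, and the
   Riemannian metric comes from [dot]. *)

Section Smooth.
Context {R : realType} {V W : normedModType R}.

(* meaningful for U open *)
Fixpoint Ck (k : nat) (U : set V) (f : V -> W) : Prop :=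
  match k with
  | 0 => forall x, U x -> {for x, continuous f}
  | k'.+1 => (forall x, U x -> differentiable f x) /\
             (forall v, Ck k' U (fun x => 'D_v f x))
  end.

Definition Cinfty (U : set V) (f : V -> W) : Prop := forall k, Ck k U f.

Definition smooth_on (A : set V) (f : V -> W) : Prop :=
  forall x, A x -> exists (U : set V) (g : V -> W),
    [/\ open_nbhs x U, Cinfty U g & forall y, A y -> U y -> f y = g y].

End Smooth.

Definition diffeo {R : realType} {V W : normedModType R}
    (A : set V) (B : set W) (f : V -> W) (g : W -> V) : Prop :=
  [/\ smooth_on A f, smooth_on B g,
      forall x, A x -> B (f x) /\ g (f x) = x &
      forall y, B y -> A (g y) /\ f (g y) = y].

Definition diffeomorphic {R : realType} {V W : normedModType R}
    (A : set V) (B : set W) : Prop :=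
  exists (f : V -> W) (g : W -> V), diffeo A B f g.

Section Submanifolds.
Context {R : realType} {n : nat}.
Implicit Types (X Y : set 'rV[R]_n) (x v : 'rV[R]_n).

Definition dot (u v : 'rV[R]_n) : R := (u *m v^T) 0 0.

Definition unit_sphere : set 'rV[R]_n := [set x | dot x x = 1].

Definition submanifold (k : nat) X : Prop :=
  forall x, X x -> exists (W : set 'rV[R]_n) (U : set 'rV[R]_k),
    [/\ open_nbhs x W, open U & diffeomorphic U (X `&` W)].

Definition curve_at X x (c : R -> 'rV[R]_n) : Prop :=
  c 0 = x /\ exists I : set R,
    [/\ open_nbhs 0 I, Cinfty I c & forall t, I t -> X (c t)].

Definition tangent X x v : Prop := exists2 c, curve_at X x c & derive1 c 0 = v.

(* The rows of E are a basis of the tangent space, when X has dimension k. *)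
Definition frame (k : nat) X x (E : 'M[R]_(k, n)) : Prop :=
  row_free E /\ forall i, tangent X x (row i E).

(* [o x E] means that E is a positively oriented basis of the tangent space
   at x: an orientation of each tangent space, such that along a continuous
   local frame field the sign is locally constant. *)
Definition orientation (k : nat) X (o : 'rV[R]_n -> 'M[R]_(k, n) -> Prop) :
    Prop :=
  (forall x E (A : 'M[R]_k), X x -> frame X x E ->
     (0 < \det A -> (o x (A *m E) <-> o x E)) /\
     (\det A < 0 -> (o x (A *m E) <-> ~ o x E))) /\
  (forall x (U : set 'rV[R]_n) (E : 'rV[R]_n -> 'M[R]_(k, n)),
     X x -> open_nbhs x U -> {within X `&` U, continuous E} ->
     (forall y, X y -> U y -> frame X y (E y)) ->
     \forall y \near x, X y -> (o y (E y) <-> o x (E x))).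

Definition orientable (k : nat) X : Prop :=
  exists o : 'rV[R]_n -> 'M[R]_(k, n) -> Prop, orientation X o.

(* The Riemannian volume form takes the value sqrt (det Gram(E)) on every
   positive basis E, and a k-form on a k-dimensional space is determined by its
   value on one basis. *)
Definition calibrated (k : nat) (phi : 'M[R]_(k, n) -> R) X : Prop :=
  exists2 o : 'rV[R]_n -> 'M[R]_(k, n) -> Prop, orientation X o &
    forall x E, X x -> frame X x E -> o x E ->
      phi E = Num.sqrt (\det (E *m E^T)).

(* Isometry of the Riemannian metrics induced from R^n; the differential of f
   maps the velocity of c to the velocity of f \o c. *)
Definition isometric X Y : Prop :=
  exists (f g : 'rV[R]_n -> 'rV[R]_n), diffeo X Y f g /\
    forall x c1 c2, X x -> curve_at X x c1 -> curve_at X x c2 ->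
      dot (derive1 (f \o c1) 0) (derive1 (f \o c2) 0) = dot (derive1 c1 0) (derive1 c2 0).

Definition cone X : set 'rV[R]_n :=
  [set y | exists t x, [/\ 0 <= t, X x & y = t *: x]].

End Submanifolds.

Section C3.
Context {R : realType}.
(* C^3 is R^(3 + 3), real parts first. *)
Implicit Types (x : 'rV[R]_(3 + 3)) (C S : set 'rV[R]_(3 + 3)).

Definition to_complex x : 'rV[R[i]]_3 :=
  \row_k (lsubmx x 0 k +i* rsubmx x 0 k).

Definition of_complex (z : 'rV[R[i]]_3) : 'rV[R]_(3 + 3) :=
  row_mx (map_mx (@complex.Re R) z) (map_mx (@complex.Im R) z).

(* Re (dz^1 /\ dz^2 /\ dz^3) evaluated on the rows of E *)
Definition ReOmega (E : 'M[R]_(3, 3 + 3)) : R :=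
  complex.Re (\det (\matrix_(j < 3) to_complex (row j E))).

Definition special_lagrangian_cone C : Prop :=
  exists S, [/\ S `<=` unit_sphere, submanifold 2 S & compact S] /\
    [/\ connected S, orientable 2 S, C = cone S & calibrated ReOmega (C `\ 0)].

Definition link C : set 'rV[R]_(3 + 3) := C `&` unit_sphere.

(* S^1 x S^1 in R^2 x R^2 *)
Definition torus2 : set 'rV[R]_(2 + 2) :=
  [set x | unit_sphere (lsubmx x) /\ unit_sphere (rsubmx x)].

Definition embedded_torus S : Prop :=
  submanifold 2 S /\ diffeomorphic torus2 S.

Definition SU3 : set 'M[R[i]]_3 :=
  [set g | g \is unitarymx /\ \det g = 1].

(* image of an injective continuous homomorphism from S^1 = R / 2 pi Z *)
Definition circle_subgroup (G : set 'M[R[i]]_3) : Prop :=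
  exists rho : R -> 'M[R[i]]_3,
    [/\ forall i j, continuous (fun t => complex.Re (rho t i j)) /\
                    continuous (fun t => complex.Im (rho t i j)),
        forall s t, rho (s + t) = rho s *m rho t,
        forall t, rho t = 1%:M <-> exists m : int, t = m%:~R * (2 * pi),
        forall t, SU3 (rho t) &
        G = range rho].

Definition unitary_act (g : 'M[R[i]]_3) x : 'rV[R]_(3 + 3) :=
  of_complex (g *m (to_complex x)^T)^T.

Definition invariant_under (G : set 'M[R[i]]_3) S : Prop :=
  forall g, G g -> unitary_act g @` S = S.

End C3.

(* Main.v *)
(** For coprime weights a = (m, m+1, -(2m+1)), which sum to zero, let C_m be the
    cone of the points (y_1 e^{i a_1 t}, y_2 e^{i a_2 t}, i y_3 e^{i a_3 t}) with y
    real, y_3 >= 0 and a_1 y_1^2 + a_2 y_2^2 + a_3 y_3^2 = 0.  In the frame of the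
    phases a tangent vector is w + i om n, with n = (a_k y_k) and w orthogonal to
    n, so the complex determinant of three of them is, up to sign, the
    determinant of the real vectors w + om n, which have the same Gram matrix:
    C_m is special Lagrangian.  The phase e^{it} is (up to a positive factor)
    conj(-i z_1^2 z_3) - i z_2^2 z_3, a globally smooth inverse, so the link is
    an embedded torus; translation of t is the circle action.

    An isometry of the punctured cones preserves the distance to the apex,
    hence the intrinsic diameter of the links.  That diameter is at least of the
    order of m, since the phase e^{it} has gradient at most 1/m, and at most 64 m;
    so the cones C_m with m a power of 64 are pairwise non-isometric. *)
Require Import Defs.
From HB Require Import structures.
From mathcomp Require Import all_boot all_order all_algebra.
From mathcomp Require Import all_classical all_reals all_analysis.
From mathcomp Require Import complex.
From mathcomp Require Import ring lra.

Set Implicit Arguments.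
Unset Strict Implicit.
Unset Printing Implicit Defensive.

Import Order.TTheory GRing.Theory Num.Theory.
Import numFieldNormedType.Exports.

Local Open Scope classical_set_scope.
Local Open Scope ring_scope.

(** * Iterated directional derivatives *)

(** The construction of [C_m] works for nonzero weights with sum zero; taking the two positive ones
    consecutive makes it explicit. Then z_1^2 z_3 and z_2^2 z_3 have weights -1 and 1, so after
    conjugating the first both point along e^{it} with nonnegative coefficients and cannot cancel.
    Real radius and phase are thus global coordinates, smooth on an open set around the punctured
    cone: the link is compared with the torus by one global map, and every velocity is computed in
    these coordinates.

    Intrinsic diameter is never defined. What is compared is the speed L at which any two points of
    the link can be joined in unit time inside the link. An isometry carries this over once it is
    known to preserve norms; that is the real obstacle, since the apex is removed and nothing is
    assumed near it.

    The factor 64 only has to be independent of m and to separate the bounds: cone m admits L = 64 m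
    and forces L >= 2 m for L >= 0, while 64 m_i <= m_j < 2 m_j for i < j. *)

Section NearEq.
Context {R : realType} {V W : normedModType R}.
Implicit Types (f g : V -> W) (x : V).

(** The difference [g - f] vanishes near [x], so the zero map satisfies the little-o expansion that
    characterises its differential; adding [f] back gives [g]. *)
Lemma near_eq_differentiable f g x :
  (\forall y \near x, f y = g y) -> differentiable f x -> differentiable g x.
Proof.
move=> fg df; pose h := g - f.
have hE y : h y = g y - f y by [].
have h0 : \forall y \near x, h y = 0.
  by apply: filterS fg => y fgy; rewrite hE fgy subrr.
have o : h \o shift x = cst (h x) + cst 0 +o_ 0 id.
  rewrite (nbhs_singleton h0) [cst 0 + cst 0](_ : _ = cst 0); last first.
    by apply/funext => y; rewrite fctE addr0.
  apply/eqaddoP => e e0; near=> y.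
  rewrite [X in `|X|](_ : _ = h (y + x)); last by rewrite !fctE /= subr0.
  rewrite (_ : h (y + x) = 0) ?normr0 ?mulr_ge0 ?(ltW e0)//.
  near: y; rewrite (near_shift 0 x) /= in h0.
  by apply: filterS h0 => y /=; rewrite subr0.
have dh : differentiable h x.
  have c0 : continuous (\0 : {linear V -> W}) by move=> ?; exact: cst_continuous.
  by apply/diff_locallyP; rewrite (diff_unique c0 o).
rewrite (_ : g = h + f); first exact: differentiableD.
by apply/funext => y; rewrite -[RHS]/(h y + f y) hE subrK.
Unshelve. all: by end_near. Qed.

Lemma derive_linear_comp (W' : normedModType R) (L : {linear W -> W'}) f x v :
  continuous L -> differentiable f x -> 'D_v (L \o f) x = L ('D_v f x).
Proof.
move=> Lc df; have dL : differentiable L (f x) by exact: linear_differentiable.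
rewrite !deriveE//; last exact: differentiable_comp.
by rewrite diff_comp//= diff_lin.
Qed.

End NearEq.

Section Calculus.
Context {R : realType} {V : normedModType R}.
Implicit Types (U : set V) (k : nat).

Lemma Ck_differentiable (W : normedModType R) k U (f : V -> W) x :
  Ck k.+1 U f -> U x -> differentiable f x.
Proof. by move=> -[+ _]; exact. Qed.

Lemma CkW (W : normedModType R) k U (f : V -> W) : Ck k.+1 U f -> Ck k U f.
Proof.
elim: k f => [|k IH] f [df Df].
  by move=> x Ux; apply: differentiable_continuous; exact: df.
by split=> // v; exact/IH/Df.
Qed.

Lemma Ck_sub (W : normedModType R) k U U' (f : V -> W) :
  U' `<=` U -> Ck k U f -> Ck k U' f.
Proof.
elim: k f => [|k IH] f U'U; first by move=> /= cf x /U'U; exact: cf.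
by move=> [df Df]; split=> [x /U'U|v]; [exact: df|exact: IH (Df v)].
Qed.

Lemma Ck_local (W : normedModType R) k U (f : V -> W) :
  (forall x, U x -> exists U', U' x /\ Ck k U' f) -> Ck k U f.
Proof.
elim: k f => [|k IH] f H; first by move=> x /H [U' [U'x /= cf]]; exact: cf.
split=> [x /H [U' [U'x [df _]]]|v]; first exact: df.
by apply: IH => x /H [U' [U'x [_ Df]]]; exists U'; split; [|exact: Df].
Qed.

(** Openness turns equality on [U] into equality near each point, so all iterated derivatives agree
    as well. The closure lemmas below use this to replace a derivative by its formula, valid only on
    [U]. *)
Lemma Ck_ext (W : normedModType R) k U (f g : V -> W) :
  open U -> (forall x, U x -> f x = g x) -> Ck k U f -> Ck k U g.
Proof.
move=> Uo; elim: k f g => [|k IH] f g fg.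
  move=> /= cf x Ux; rewrite /prop_for/continuous_at -fg//.
  apply: cvg_trans (cf x Ux); apply: near_eq_cvg.
  by apply: filterS (open_nbhs_nbhs (conj Uo Ux)) => y /fg.
have near_fg x : U x -> \forall y \near x, f y = g y.
  by move=> Ux; apply: filterS (open_nbhs_nbhs (conj Uo Ux)) => y /fg.
move=> [df Df]; split=> [x Ux|v].
  exact: near_eq_differentiable (near_fg x Ux) (df x Ux).
apply: (IH (fun x => 'D_v f x)) (Df v) => x Ux.
exact: near_eq_derive (near_fg x Ux).
Qed.

Lemma Ck_cst (W : normedModType R) k U (a : W) : Ck k U (fun=> a).
Proof.
elim: k a => [|k IH] a; first by move=> x _; exact: cst_continuous.
split=> [x _|v]; first exact: differentiable_cst.
rewrite [X in Ck _ _ X](_ : _ = fun=> 0); first exact: IH.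
by apply/funext => x; exact: derive_cst.
Qed.

Lemma CkD (W : normedModType R) k U (f g : V -> W) : open U ->
  Ck k U f -> Ck k U g -> Ck k U (fun x => f x + g x).
Proof.
move=> Uo; elim: k f g => [|k IH] f g.
  by move=> /= cf cg x Ux; apply: continuousD; [exact: cf|exact: cg].
move=> [df Df] [dg Dg]; split=> [x Ux|v].
  by apply: differentiableD; [exact: df|exact: dg].
apply: (Ck_ext Uo _ (IH _ _ (Df v) (Dg v))) => x Ux.
by rewrite -deriveD//; apply: diff_derivable; [exact: df|exact: dg].
Qed.

Lemma Ck_sum (W : normedModType R) k U n (f : 'I_n -> V -> W) : open U ->
  (forall i, Ck k U (f i)) -> Ck k U (fun x => \sum_i f i x).
Proof.
move=> Uo fk; elim: n f fk => [|n IH] f fk.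
  by rewrite [X in Ck _ _ X](_ : _ = fun=> 0); [exact: Ck_cst|apply/funext => x; rewrite big_ord0].
rewrite [X in Ck _ _ X](_ : _ = fun x => f ord0 x + \sum_i f (lift ord0 i) x).
  by apply: CkD => //; exact: IH.
by apply/funext => x; rewrite big_ord_recl.
Qed.

Lemma Ck_linear_comp (W W' : normedModType R) k U (L : {linear W -> W'})
    (f : V -> W) : open U -> continuous L -> Ck k U f -> Ck k U (L \o f).
Proof.
move=> Uo Lc; elim: k f => [|k IH] f.
  by move=> /= cf x Ux; apply: continuous_comp; [exact: cf|exact: Lc].
move=> [df Df]; split=> [x Ux|v].
  by apply: differentiable_comp; [exact: df|exact: linear_differentiable].
apply: (Ck_ext Uo _ (IH _ (Df v))) => x Ux.
by rewrite derive_linear_comp//; exact: df.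
Qed.

Lemma Ck_linear (W : normedModType R) k U (L : {linear V -> W}) :
  continuous L -> Ck k U L.
Proof.
case: k => [|k] Lc; first by move=> x _; exact: Lc.
split=> [x _|v]; first exact: linear_differentiable.
rewrite [X in Ck _ _ X](_ : _ = fun=> L v); first exact: Ck_cst.
apply/funext => x; rewrite deriveE; last exact: linear_differentiable.
by rewrite diff_lin.
Qed.

Lemma Ck_id k U : Ck k U (fun x => x).
Proof. by apply: (@Ck_linear _ _ _ (idfun : {linear V -> V})) => x; exact: cvg_id. Qed.

Lemma CkN (W : normedModType R) k U (f : V -> W) : open U ->
  Ck k U f -> Ck k U (fun x => - f x).
Proof.
move=> Uo; apply: (@Ck_linear_comp _ _ _ _ (-%R : {linear W -> W})) => //.
by move=> x; exact: opp_continuous.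
Qed.

Lemma CkZl (W : normedModType R) k U (f : V -> R) (w : W) : open U ->
  Ck k U f -> Ck k U (fun x => f x *: w).
Proof.
move=> Uo; pose L (a : R) := a *: w.
have Ll : linear L by move=> a b c; rewrite /L scalerDl scalerA.
pose LM := GRing.isLinear.Build _ _ _ _ _ Ll.
pose LL : {linear R -> W} := HB.pack L LM.
by apply: (@Ck_linear_comp _ _ _ _ LL) => //; exact: scalel_continuous.
Qed.

Implicit Types f g : V -> R.

Lemma CkM k U f g : open U ->
  Ck k U f -> Ck k U g -> Ck k U (fun x => f x * g x).
Proof.
move=> Uo; elim: k f g => [|k IH] f g.
  by move=> /= cf cg x Ux; apply: continuousM; [exact: cf|exact: cg].
move=> fk gk; have [df Df] := fk; have [dg Dg] := gk.
split=> [x Ux|v]; first by apply: differentiableM; [exact: df|exact: dg].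
apply: (Ck_ext Uo _ (CkD Uo (IH _ _ (CkW fk) (Dg v)) (IH _ _ (CkW gk) (Df v)))).
move=> x Ux; rewrite [RHS](@deriveM _ _ f g)//; apply: diff_derivable;
  [exact: df|exact: dg].
Qed.

Lemma CkX k U f n : open U -> Ck k U f -> Ck k U (fun x => f x ^+ n).
Proof.
move=> Uo fk; elim: n => [|n IH].
  by rewrite [X in Ck _ _ X](_ : _ = fun=> 1); [exact: Ck_cst|apply/funext => x; rewrite expr0].
rewrite [X in Ck _ _ X](_ : _ = fun x => f x * f x ^+ n); first exact: CkM.
by apply/funext => x; rewrite exprS.
Qed.

(** The derivative of [1 / f] is a polynomial in [1 / f] and the derivative of [f], so regularity of
    [1 / f] at order [k] feeds order [k.+1]. [Ck_sqrt] bootstraps in the same way, and [Ck_cos_sin]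
    does so for both functions at once. *)
Lemma CkV k U f : open U -> (forall x, U x -> f x != 0) ->
  Ck k U f -> Ck k U (fun x => (f x)^-1).
Proof.
move=> Uo f0; elim: k => [|k IH].
  by move=> /= cf x Ux; apply: continuousV; [exact: f0|exact: cf].
move=> fk; have [df Df] := fk; have ik := IH (CkW fk).
split=> [x Ux|v]; first by apply: differentiableV; [exact: df|exact: f0].
apply: (Ck_ext Uo _ (CkN Uo (CkM Uo (CkX 2 Uo ik) (Df v)))) => x Ux.
rewrite (@deriveV _ _ f) ?f0//; last by apply: diff_derivable; exact: df.
by rewrite exprVn scaleNr.
Qed.

Lemma derive_comp1 f (h : R -> R) x v a :
  differentiable f x -> is_derive (f x) 1 h a ->
  differentiable (h \o f) x /\ 'D_v (h \o f) x = 'D_v f x * a.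
Proof.
move=> df [/derivable1_diffP dh ha].
have dhf : differentiable (h \o f) x by exact: differentiable_comp.
split=> //; rewrite !deriveE// diff_comp//= diff1E//.
by rewrite derive1E ha.
Qed.

Lemma Ck_sqrt k U f : open U -> (forall x, U x -> 0 < f x) ->
  Ck k U f -> Ck k U (fun x => Num.sqrt (f x)).
Proof.
move=> Uo f0; elim: k => [|k IH].
  move=> /= cf x Ux; apply: (@continuous_comp _ _ _ f (@Num.sqrt R)); first exact: cf.
  exact: sqrt_continuous.
move=> fk; have [df Df] := fk; have ik := IH (CkW fk).
have D x v (Ux : U x) := derive_comp1 v (df x Ux) (is_derive1_sqrt (f0 x Ux)).
split=> [x Ux|v]; first exact: (D x 0 Ux).1.
have s2 x : U x -> 2 * Num.sqrt (f x) != 0.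
  by move=> Ux; rewrite gt_eqF// mulr_gt0// sqrtr_gt0 f0.
have ck : Ck k U (fun x => 'D_v f x * (2 * Num.sqrt (f x))^-1).
  apply: CkM => //; first exact: Df.
  by apply: CkV => //; apply: CkM => //; exact: Ck_cst.
apply: (Ck_ext Uo _ ck).
by move=> x Ux; rewrite (D x v Ux).2.
Qed.

Lemma Ck_cos_sin k U f : open U -> Ck k U f ->
  Ck k U (fun x => cos (f x)) /\ Ck k U (fun x => sin (f x)).
Proof.
move=> Uo; elim: k => [|k IH].
  move=> /= cf; split=> x Ux.
    apply: (@continuous_comp _ _ _ f (@cos R)); first exact: cf.
    exact: continuous_cos.
  apply: (@continuous_comp _ _ _ f (@sin R)); first exact: cf.
  exact: continuous_sin.
move=> fk; have [df Df] := fk; have [ck sk] := IH (CkW fk).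
have Dc x v (Ux : U x) := derive_comp1 v (df x Ux) (is_derive_cos (f x)).
have Ds x v (Ux : U x) := derive_comp1 v (df x Ux) (is_derive_sin (f x)).
split; split=> [x Ux|v].
- exact: (Dc x 0 Ux).1.
- apply: (Ck_ext Uo _ (CkM Uo (Df v) (CkN Uo sk))) => x Ux.
  by rewrite (Dc x v Ux).2.
- exact: (Ds x 0 Ux).1.
- apply: (Ck_ext Uo _ (CkM Uo (Df v) ck)) => x Ux.
  by rewrite (Ds x v Ux).2.
Qed.

Lemma Ck_coord k U n (f : V -> 'rV[R]_n) (i : 'I_n) : open U ->
  Ck k U f -> Ck k U (fun x => f x 0 i).
Proof.
move=> Uo; pose L (a : 'rV[R]_n) := a 0 i.
have Ll : linear L by move=> a b c; rewrite /L !mxE.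
pose LM := GRing.isLinear.Build _ _ _ _ _ Ll.
pose LL : {linear 'rV[R]_n -> R} := HB.pack L LM.
apply: (@Ck_linear_comp _ _ _ _ LL) => //; exact: coord_continuous.
Qed.

Lemma Ck_rV k U n (f : V -> 'rV[R]_n) : open U ->
  (forall i, Ck k U (fun x => f x 0 i)) -> Ck k U f.
Proof.
move=> Uo fk.
rewrite (_ : f = fun x => \sum_i f x 0 i *: delta_mx 0 i).
  by apply: Ck_sum => // i; exact: CkZl.
by apply/funext => x; exact: row_sum_delta.
Qed.

End Calculus.

Section Composition.
Context {R : realType} {V : normedModType R}.

(** The chain rule is written in coordinates: a directional derivative of the composite is a finite
    sum of products of scalar functions, and the induction hypothesis applies with [g] replaced by
    its partial derivatives. *)
Lemma Ck_comp1 k n (U : set V) (U' : set 'rV[R]_n) (f : V -> 'rV[R]_n)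
    (g : 'rV[R]_n -> R) : open U -> (forall x, U x -> U' (f x)) ->
  Ck k U f -> Ck k U' g -> Ck k U (fun x => g (f x)).
Proof.
move=> Uo fU; elim: k f g fU => [|k IH] f g fU.
  by move=> /= cf cg x Ux; apply: continuous_comp; [exact: cf|exact: cg (fU _ Ux)].
move=> fk gk; have [df Df] := fk; have [dg Dg] := gk.
split=> [x Ux|v].
  by apply: differentiable_comp; [exact: df|exact: dg (fU _ Ux)].
have S : Ck k U (fun x => \sum_i 'D_v f x 0 i * 'D_(delta_mx 0 i) g (f x)).
  apply: Ck_sum => // i; apply: CkM => //; first exact: Ck_coord (Df v).
  by apply: (IH f ('D_(delta_mx 0 i) g)) => //; [exact: CkW|exact: Dg].
apply: (Ck_ext Uo _ S) => x Ux.
rewrite [RHS]deriveE; last first.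
  by apply: (@differentiable_comp _ _ _ _ f g); [exact: df|exact: dg (fU _ Ux)].
rewrite (@diff_comp _ _ _ _ f g)/=; [|exact: df|exact: dg (fU _ Ux)].
rewrite -(deriveE v (df x Ux)).
rewrite {2}(row_sum_delta ('D_v f x)) linear_sum; apply: eq_bigr => i _.
by rewrite linearZ/= (deriveE _ (dg _ (fU _ Ux))).
Qed.

Lemma Ck_comp k n p (U : set V) (U' : set 'rV[R]_n) (f : V -> 'rV[R]_n)
    (g : 'rV[R]_n -> 'rV[R]_p) :
  open U -> open U' -> (forall x, U x -> U' (f x)) ->
  Ck k U f -> Ck k U' g -> Ck k U (fun x => g (f x)).
Proof.
move=> Uo U'o fU fk gk; apply: Ck_rV => // i.
by apply: (Ck_comp1 Uo fU fk (g := fun y => g y 0 i)); exact: Ck_coord.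
Qed.

End Composition.

(** * Smooth maps between subsets and the Euclidean inner product *)

Section SmoothMaps.
Context {R : realType}.

Lemma open_preimage_within {V : normedModType R} n (U : set V) (W : set 'rV[R]_n) (f : V -> 'rV[R]_n) :
  open U -> open W -> Cinfty U f -> open (U `&` f @^-1` W).
Proof.
move=> Uo Wo fs; rewrite openE => x [Ux Wfx]; apply: filterI.
  exact: open_nbhs_nbhs.
by apply: (fs 0%N x Ux); exact: open_nbhs_nbhs.
Qed.

Lemma Cinfty_smooth_on {V W : normedModType R} (A U : set V) (f : V -> W) :
  open U -> A `<=` U -> Cinfty U f -> smooth_on A f.
Proof. by move=> Uo AU fs x Ax; exists U, f; split=> //; split=> //; exact: AU. Qed.

Lemma smooth_onW {V W : normedModType R} (A B : set V) (f : V -> W) :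
  A `<=` B -> smooth_on B f -> smooth_on A f.
Proof.
move=> AB fs x Ax; have [U [g [xU gs fg]]] := fs x (AB x Ax).
by exists U, g; split=> // y /AB; exact: fg.
Qed.

Lemma smooth_on_Cinfty {V W : normedModType R} (A : set V) (f : V -> W) :
  open A -> smooth_on A f -> Cinfty A f.
Proof.
move=> Ao fs k; apply: Ck_local => x Ax.
have [U [g [[Uo Ux] gs fg]]] := fs x Ax.
exists (A `&` U); split=> //.
have AUo : open (A `&` U) by exact: openI.
apply: (Ck_ext AUo (f := g)) => [y [Ay Uy]|]; first exact/esym/fg.
by apply: Ck_sub (gs k) => y [].
Qed.

Lemma smooth_on_comp {V : normedModType R} n p (A : set V) (B : set 'rV[R]_n)
    (f : V -> 'rV[R]_n) (g : 'rV[R]_n -> 'rV[R]_p) :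
  smooth_on A f -> smooth_on B g -> (forall x, A x -> B (f x)) ->
  smooth_on A (g \o f).
Proof.
move=> fs gs AB x Ax.
have [U [f1 [[Uo Ux] f1s ff1]]] := fs x Ax.
have [U' [g1 [[U'o U'fx] g1s gg1]]] := gs _ (AB x Ax).
exists (U `&` f1 @^-1` U'), (g1 \o f1); split.
- split; first exact: open_preimage_within.
  by split=> //=; rewrite -ff1.
- move=> k; apply: (Ck_comp (U' := U')) => //.
  + exact: open_preimage_within.
  + by move=> y [].
  + by apply: Ck_sub (f1s k) => y [].
- move=> y Ay [Uy U'y] /=; rewrite -(ff1 y Ay Uy); apply: gg1; first exact: AB.
  by rewrite (ff1 y Ay Uy).
Qed.

Lemma smooth_on_continuous {V W : normedModType R} (A : set V) (f : V -> W) x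
    (N : set W) : smooth_on A f -> A x -> nbhs (f x) N ->
  \forall y \near x, A y -> N (f y).
Proof.
move=> fs Ax; have [U [g [[Uo Ux] gs fg]]] := fs x Ax.
rewrite (fg x Ax Ux) => /(gs 0%N x Ux) gN; near=> y => Ay.
rewrite fg//; first by near: y; exact: gN.
by near: y; exact: open_nbhs_nbhs.
Unshelve. all: by end_near. Qed.

Lemma submanifold_diffeo k n p (X : set 'rV[R]_n) (Y : set 'rV[R]_p) f g :
  diffeo X Y f g -> submanifold k X -> submanifold k Y.
Proof.
move=> [fs gs fX gY] Xk y Yy; have [Xgy fgy] := gY y Yy.
have [W [U [[Wo Wgy] Uo [phi [psi [phis psis phiU psiW]]]]]] := Xk _ Xgy.
(* Off [Y] the map [g] is arbitrary, so the preimage of [W] is taken relative to [Y]. Continuity of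
   [g] along [Y] puts every point of [Y] sent into [W] in the interior of this set. *)
pose W' := interior [set z | Y z -> W (g z)].
have YW' z : Y z -> W' z <-> W (g z).
  move=> Yz; split=> [/interior_subset|Wgz]; first exact.
  exact: (smooth_on_continuous gs Yz (open_nbhs_nbhs (conj Wo Wgz))).
exists W', U; split=> //.
  by split; [exact: open_interior|exact/YW'].
exists (f \o phi), (psi \o g); split.
- by apply: smooth_on_comp phis fs _ => x /phiU[[]].
- apply: smooth_on_comp (smooth_onW _ gs) psis _; first by move=> z [].
  by move=> z [Yz W'z]; split; [exact: (gY z Yz).1|exact/YW'].
- move=> x Ux; have [[Xx Wx] px] := phiU x Ux; have [Yfx gfx] := fX _ Xx.
  by split; [split=> //; apply/YW' => //=|]; rewrite /= gfx.
- move=> z [Yz /(YW' z Yz) Wgz]; have [Xgz fgz] := gY z Yz.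
  have [Uz pz] := psiW (g z) (conj Xgz Wgz).
  by split=> //=; rewrite pz.
Qed.

End SmoothMaps.

Section Dot.
Context {R : realType} {n : nat}.
Implicit Types u v : 'rV[R]_n.

Lemma dotE u v : dot u v = \sum_i u 0 i * v 0 i.
Proof. by rewrite /dot mxE; apply: eq_bigr => i _; rewrite mxE. Qed.

Lemma dotC u v : dot u v = dot v u.
Proof. by rewrite !dotE; apply: eq_bigr => i _; rewrite mulrC. Qed.

Lemma dotDl u v w : dot (u + v) w = dot u w + dot v w.
Proof. by rewrite !dotE -big_split; apply: eq_bigr => i _; rewrite mxE mulrDl. Qed.

Lemma dotZl a u v : dot (a *: u) v = a * dot u v.
Proof. by rewrite !dotE mulr_sumr; apply: eq_bigr => i _; rewrite mxE mulrA. Qed.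

Lemma dotNl u v : dot (- u) v = - dot u v.
Proof. by rewrite -scaleN1r dotZl mulN1r. Qed.

Lemma dotDr u v w : dot w (u + v) = dot w u + dot w v.
Proof. by rewrite dotC dotDl !(dotC w). Qed.

Lemma dotZr a u v : dot v (a *: u) = a * dot v u.
Proof. by rewrite dotC dotZl (dotC v). Qed.

Lemma dotNr u v : dot v (- u) = - dot v u.
Proof. by rewrite dotC dotNl (dotC v). Qed.

Lemma dot_ge0 u : 0 <= dot u u.
Proof. by rewrite dotE sumr_ge0// => i _; exact: sqr_ge0. Qed.

Lemma dot_eq0 u : (dot u u == 0) = (u == 0).
Proof.
rewrite dotE psumr_eq0 => [|i _]; last exact: sqr_ge0.
apply/allP/eqP => [u0|-> i _]; last by rewrite !mxE mul0r eqxx.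
apply/rowP => i; rewrite mxE; apply/eqP.
by have := u0 i (mem_index_enum _); rewrite mulf_eq0 orbb.
Qed.

Lemma dot_gt0 u : (0 < dot u u) = (u != 0).
Proof. by rewrite lt_neqAle dot_ge0 andbT eq_sym dot_eq0. Qed.

Lemma cauchy_schwarz u v : dot u v ^+ 2 <= dot u u * dot v v.
Proof.
have [->|v0] := eqVneq v 0.
  by rewrite -(scale0r (0 : 'rV[R]_n)) !dotZr !mul0r mulr0 expr0n.
have := dot_ge0 (dot v v *: u - dot u v *: v).
rewrite !dotDl !dotDr !dotNl !dotNr !dotZl !dotZr (dotC v u).
rewrite (_ : _ + _ = dot v v * (dot u u * dot v v - dot u v ^+ 2)); last ring.
by rewrite pmulr_rge0 ?dot_gt0// subr_ge0.
Qed.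

Lemma sqr_coord_le_dot u i : u 0 i ^+ 2 <= dot u u.
Proof.
rewrite dotE (bigD1 i)//= -expr2 lerDl sumr_ge0// => j _; exact: sqr_ge0.
Qed.

(** Bridge from Euclidean length, in which speeds are measured, to the sup norm, in which limits are
    taken. *)
Lemma norm_lt_dot u e : 0 < e -> dot u u < e ^+ 2 -> `|u| < e.
Proof.
move=> e0 ue; rewrite [ltLHS]mx_normrE; apply: bigmax_lt => //= -[i j] _ /=.
rewrite ord1 -(ltr_pXn2r (n := 2))// ?nnegrE ?ltW//.
by rewrite real_normK ?num_real// (le_lt_trans (sqr_coord_le_dot _ _)).
Qed.

Lemma Ck_dot (V : normedModType R) k (U : set V) (f g : V -> 'rV[R]_n) :
  open U -> Ck k U f -> Ck k U g -> Ck k U (fun x => dot (f x) (g x)).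
Proof.
move=> Uo fk gk; have S : Ck k U (fun x => \sum_i f x 0 i * g x 0 i).
  by apply: Ck_sum => // i; apply: CkM => //; exact: Ck_coord.
by apply: Ck_ext S => // x _; rewrite dotE.
Qed.

Lemma is_derive_dotr (c : R -> 'rV[R]_n) u t : derivable c t 1 ->
  is_derive t 1 (fun s => dot u (c s)) (dot u (derive1 c t)).
Proof.
move=> /derivable1_diffP dc.
pose L v := dot u v.
have Ll : linear L by move=> a v w; rewrite /L dotDr dotZr.
pose LM := GRing.isLinear.Build _ _ _ _ _ Ll.
pose LL : {linear 'rV[R]_n -> R} := HB.pack L LM.
have Lc : continuous LL.
  move=> x; have S : Ck 0 setT (dot u) := Ck_dot openT (Ck_cst _ _ u) (@Ck_id _ _ _ _).
  exact: (S x I).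
rewrite derive1E; apply: DeriveDef; last exact: (derive_linear_comp (L := LL)).
apply/derivable1_diffP; apply: (@differentiable_comp _ _ _ _ c LL) => //.
exact: linear_differentiable.
Qed.

(** The scalar mean value theorem is applied to the projection of [c] on its own increment [u];
    Cauchy-Schwarz then gives the bound multiplied by [dot u u], which is cancelled. *)
Lemma dot_increment_le (c : R -> 'rV[R]_n) (a b L : R) : a <= b ->
  (forall t, t \in `[a, b] -> derivable c t 1) ->
  (forall t, t \in `[a, b] -> dot (derive1 c t) (derive1 c t) <= L ^+ 2) ->
  dot (c b - c a) (c b - c a) <= (L * (b - a)) ^+ 2.
Proof.
move=> ab dc Lc; set u := c b - c a.
have Du t : t \in `[a, b] -> is_derive t 1 (fun s => dot u (c s)) (dot u (derive1 c t)).
  by move=> /dc; exact: is_derive_dotr.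
have [x xab] := MVT_segment ab (fun x xab => Du x (subset_itv_oo_cc xab))
  (derivable_within_continuous (fun t tab => @ex_derive _ _ _ _ _ _ _ (Du t tab))).
rewrite -dotNr -dotDr -/u => E.
have [->|u0] := eqVneq (dot u u) 0; first exact: sqr_ge0.
have u1 : 0 < dot u u by rewrite lt_neqAle eq_sym u0 dot_ge0.
rewrite -(ler_pM2l u1) -expr2 [X in X ^+ 2 <= _]E.
rewrite [leLHS]exprMn [X in _ <= _ * X]exprMn [leRHS]mulrA ler_wpM2r ?sqr_ge0//.
by rewrite (le_trans (cauchy_schwarz _ _))// ler_wpM2l ?dot_ge0// Lc.
Qed.

End Dot.

(** * Isometries of punctured cones *)

Section Isometries.
Context {R : realType} {n : nat}.
Implicit Types (X Y : set 'rV[R]_n) (c : R -> 'rV[R]_n).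

Definition isometry X Y (f g : 'rV[R]_n -> 'rV[R]_n) : Prop :=
  diffeo X Y f g /\
  forall x c1 c2, X x -> curve_at X x c1 -> curve_at X x c2 ->
    dot (derive1 (f \o c1) 0) (derive1 (f \o c2) 0) =
    dot (derive1 c1 0) (derive1 c2 0).

Lemma Cinfty_curve_comp X (f : 'rV[R]_n -> 'rV[R]_n) c (I : set R) :
  open I -> smooth_on X f -> Cinfty I c -> (forall t, I t -> X (c t)) ->
  Cinfty I (f \o c).
Proof.
move=> Io fs cs cX; apply: smooth_on_Cinfty => //.
exact: smooth_on_comp (Cinfty_smooth_on Io (@subset_refl _ I) cs) fs cX.
Qed.

Lemma curve_at_comp X Y (f : 'rV[R]_n -> 'rV[R]_n) x c :
  smooth_on X f -> (forall x, X x -> Y (f x)) ->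
  curve_at X x c -> curve_at Y (f x) (f \o c).
Proof.
move=> fs fX [c0 [I [[Io I0] cs cX]]]; split; first by rewrite /= c0.
exists I; split=> // [|t It]; last exact/fX/cX.
exact: Cinfty_curve_comp cX.
Qed.

(** The metric identity for [f] is applied to [g \o c1] and [g \o c2], whose images under [f] agree
    with [c1] and [c2] near 0. *)
Lemma isometry_sym X Y f g : isometry X Y f g -> isometry Y X g f.
Proof.
move=> [[fs gs fX gY] fm]; split=> [|y c1 c2 Yy c1y c2y].
  by split; [exact: gs|exact: fs|exact: gY|exact: fX].
have gX z : Y z -> X (g z) by move=> /gY[].
rewrite -(fm (g y)); [|exact: gX|exact: curve_at_comp c1y|exact: curve_at_comp c2y].
suff fgc c : curve_at Y y c -> derive1 (f \o (g \o c)) 0 = derive1 c 0.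
  by rewrite !fgc.
move=> [_ [I [I0 _ cY]]]; rewrite !derive1E; apply: near_eq_derive.
by apply: filterS (open_nbhs_nbhs I0) => t /cY /gY[].
Qed.

Lemma Ck_shift k (I : set R) c (s : R) :
  Ck k I c -> Ck k [set t | I (t + s)] (c \o shift s).
Proof.
elim: k c => [|k IH] c.
  move=> /= cI t /= It; apply: (@continuous_comp _ _ _ (shift s) c).
    by apply: continuousD; [exact: cvg_id|exact: cst_continuous].
  exact: cI.
move=> [dc Dc]; split=> [t /= It|v].
  apply: (@differentiable_comp _ _ _ _ (shift s) c); last exact: dc (t + s) It.
  have S : Ck 1 setT (shift s : R -> R).
    by apply: CkD; [exact: openT|exact: Ck_id|exact: Ck_cst].
  exact: (Ck_differentiable (x := t) S).
rewrite (_ : (fun t => _) = (fun t => 'D_v c t) \o shift s).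
  by apply: IH; exact: Dc.
apply/funext => t; rewrite /= /derive.
set u := fun h => h^-1 *: _; set w := fun h => h^-1 *: _.
by have -> : u = w by apply/funext => h; rewrite /u /w /= addrA.
Qed.

Lemma derive1_shift c (s t : R) : derive1 (c \o shift s) t = derive1 c (t + s).
Proof.
rewrite /derive1; set u := fun h => h^-1 *: _; set w := fun h => h^-1 *: _.
by have -> : u = w by apply/funext => h; rewrite /u /w /= addrA.
Qed.

Lemma curve_at_shift X (I : set R) c t : open I -> Cinfty I c ->
  (forall s, I s -> X (c s)) -> I t -> curve_at X (c t) (c \o shift t).
Proof.
move=> Io cs cX It; split; first by rewrite /= add0r.
exists [set s | I (s + t)]; split.
- split; last by rewrite /= add0r.
  have := @open_comp _ _ (shift t) I; apply=> // x _.
  by apply: continuousD; [exact: cvg_id|exact: cst_continuous].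
- by move=> k; exact: Ck_shift.
- by move=> s /= /cX.
Qed.

Lemma isometry_speed X Y f g (I : set R) c t : isometry X Y f g ->
  open I -> Cinfty I c -> (forall s, I s -> X (c s)) -> I t ->
  dot (derive1 (f \o c) t) (derive1 (f \o c) t) = dot (derive1 c t) (derive1 c t).
Proof.
move=> [[fs _ _ _] fm] Io cs cX It.
have ct := curve_at_shift Io cs cX It.
have := fm _ _ _ (cX t It) ct ct.
by rewrite compA !derive1_shift add0r.
Qed.

(* The radial segment from x to the deleted apex has finite length |x|, so its
   image is a Cauchy curve; by continuity of g it can only converge to 0. *)
Lemma isometry_dot_le X Y f g x : isometry X Y f g ->
  ~ X 0 -> (forall s y, 0 < s -> X y -> X (s *: y)) -> closed (Y `|` [set 0]) ->
  X x -> dot (f x) (f x) <= dot x x.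
Proof.
move=> fg X0 Xs Yc Xx; have [[fs gs fX gY] _] := fg.
pose c (s : R) := (1 - s) *: x; pose I : set R := [set s | s < 1].
have Io : open I by exact: open_lt.
have ks k : Ck k setT (fun s : R => 1 - s).
  apply: CkD; [exact: openT|exact: Ck_cst|].
  by apply: CkN; [exact: openT|exact: Ck_id].
have csT : Cinfty setT c by move=> k; apply: CkZl; [exact: openT|exact: ks].
have cs : Cinfty I c by move=> k; apply: Ck_sub (csT k).
have cX s : I s -> X (c s) by move=> s1; apply: Xs => //; rewrite subr_gt0.
pose y := f \o c.
have ys : Cinfty I y by exact: Cinfty_curve_comp cX.
have c' s : derive1 c s = - x.
  have dk : differentiable (fun s : R => 1 - s) s.
    exact: Ck_differentiable (ks 1%N) _.
  rewrite derive1E deriveE; last exact: (Ck_differentiable (csT 1%N)).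
  by rewrite (diffZl x dk) -deriveE// -derive1E derive1_onem scaleN1r.
have yL a b : a <= b -> b < 1 ->
    dot (y b - y a) (y b - y a) <= dot x x * (b - a) ^+ 2.
  move=> ab b1; rewrite -[dot x x]sqr_sqrtr ?dot_ge0// -exprMn.
  have abI t : t \in `[a, b] -> I t.
    by rewrite in_itv/= => /andP[_ tb]; exact: le_lt_trans b1.
  apply: dot_increment_le => // t /abI It.
    by apply/derivable1_diffP; apply: Ck_differentiable (ys 1%N) It.
  rewrite (isometry_speed fg Io cs cX It) c' dotNl dotNr opprK.
  by rewrite sqr_sqrtr ?dot_ge0.
have D0 := dot_ge0 x.
have /cvg_ex[l yl] : cvg (y s @[s --> 1^'-]).
  apply/cauchy_cvgP; apply/cauchy_exP => e e0.
  (* With [D = dot x x], the distance covered after time [1 - d] has square at most [D * d ^+ 2],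
     which is below [e ^+ 2 = d ^+ 2 * (1 + D) ^+ 2]. *)
  pose d := e / (1 + dot x x).
  have d0 : 0 < d by rewrite divr_gt0// ltr_pwDl.
  exists (y (1 - d)); suff : \forall s \near 1^'-, ball (y (1 - d)) e (y s) by [].
  near=> s; rewrite -ball_normE/= distrC.
  have s1 : s < 1 by near: s; exact: nbhs_left_lt.
  have ds : 1 - d < s by near: s; apply: nbhs_left_gt; rewrite ltrBlDr ltrDl.
  apply: norm_lt_dot => //; apply: le_lt_trans (yL _ _ (ltW ds) s1) _.
  apply: (@le_lt_trans _ _ (dot x x * d ^+ 2)).
    by rewrite ler_wpM2l// ler_pXn2r ?nnegrE//; lra.
  have -> : e = d * (1 + dot x x) by rewrite divfK// gt_eqF// ltr_pwDl.
  rewrite [ltRHS]exprMn mulrC ltr_pM2l ?exprn_gt0//.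
  by nra.
have ysY : \forall s \near 1^'-, Y (y s) /\ g (y s) = c s.
  near=> s; have /cX /fX[] // : I s by near: s; exact: nbhs_left_lt.
have Yl : (Y `|` [set 0]) l.
  by apply: closed_cvg yl => //; apply: filterS ysY => s [Yys _]; left.
have c1 : c s @[s --> 1^'-] --> (0 : 'rV[R]_n).
  have := csT 0%N 1 Logic.I; rewrite /prop_for /continuous_at /c subrr scale0r.
  exact: cvg_at_left_filter.
(* Were the limit in [Y], continuity of [g] there would make [g l] the limit of the radial segment,
   that is the apex, which [X] omits. With [l = 0] the increment bound, passed to the limit,
   compares the norm of [f x] with that of [x]. *)
have l0 : l = 0.
  case: Yl => // Yl; exfalso; apply: X0.
  suff <- : g l = 0 by exact: (gY l Yl).1.
  apply: cvg_unique c1 => //.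
  move=> N /(smooth_on_continuous gs Yl) /yl; rewrite !nbhs_simpl /= => H.
  suff : \forall s \near 1^'-, N (c s) by [].
  near=> s; have [Yys <-] : Y (y s) /\ g (y s) = c s by near: s.
  by have : Y (y s) -> N (g (y s)); [near: s|exact].
have h0 : Ck 0 setT (fun v : 'rV[R]_n => dot (v - y 0) (v - y 0)).
  apply: Ck_dot; first exact: openT.
  + by apply: CkD; [exact: openT|exact: Ck_id|exact: Ck_cst].
  + by apply: CkD; [exact: openT|exact: Ck_id|exact: Ck_cst].
have hc : dot (y s - y 0) (y s - y 0) @[s --> 1^'-] --> dot (l - y 0) (l - y 0).
  by apply: (continuous_cvg _ (h0 l Logic.I)).
have : [set r | r <= dot x x] (dot (l - y 0) (l - y 0)).
  apply: closed_cvg hc; first exact: closed_le.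
  near=> s; have s1 : s < 1 by near: s; exact: nbhs_left_lt.
  have s0 : 0 < s by near: s; exact: nbhs_left_gt.
  apply: le_trans (yL _ _ (ltW s0) s1) _.
  by rewrite subr0 ler_piMr// exprn_ile1// ltW.
by rewrite l0 /= sub0r dotNl dotNr opprK /y /= /c subr0 scale1r.
Unshelve. all: by end_near. Qed.

Lemma isometry_dot X Y f g x : isometry X Y f g ->
  ~ X 0 -> (forall s y, 0 < s -> X y -> X (s *: y)) -> closed (X `|` [set 0]) ->
  ~ Y 0 -> (forall s y, 0 < s -> Y y -> Y (s *: y)) -> closed (Y `|` [set 0]) ->
  X x -> dot (f x) (f x) = dot x x.
Proof.
move=> fg X0 Xs Xc Y0 Ys Yc Xx; have [[_ _ fX _] _] := fg.
have [Yfx gfx] := fX x Xx.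
apply/eqP; rewrite eq_le (isometry_dot_le fg X0 Xs Yc)//=.
by have := isometry_dot_le (isometry_sym fg) Y0 Ys Xc Yfx; rewrite gfx.
Qed.

(** Stands for: the unit link of [X] has intrinsic diameter at most [L]. Fixing the time interval
    and bounding the speed avoids arc length and infima. Only norms and speeds occur, both of which
    isometries of punctured cones preserve. *)
Definition joined_at_speed (L : R) X : Prop :=
  forall p q, X p -> X q -> dot p p = 1 -> dot q q = 1 ->
  exists (I : set R) c,
    [/\ open I, `[0, 1] `<=` I, Cinfty I c, c 0 = p & c 1 = q] /\
    forall t, I t -> [/\ X (c t), dot (c t) (c t) = 1 &
                         dot (derive1 c t) (derive1 c t) <= L ^+ 2].

Lemma isometry_joined_at_speed L X Y f g : isometry X Y f g ->
  ~ X 0 -> (forall s y, 0 < s -> X y -> X (s *: y)) -> closed (X `|` [set 0]) ->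
  ~ Y 0 -> (forall s y, 0 < s -> Y y -> Y (s *: y)) -> closed (Y `|` [set 0]) ->
  joined_at_speed L X -> joined_at_speed L Y.
Proof.
move=> fg X0 Xs Xc Y0 Ys Yc XL p q Yp Yq p1 q1.
have [[fs gs fX gY] _] := fg; have gf := isometry_sym fg.
have [Xgp fgp] := gY p Yp; have [Xgq fgq] := gY q Yq.
have [||I [c [[Io I01 cs c0 c1] cI]]] := XL (g p) (g q) Xgp Xgq.
- by rewrite (isometry_dot gf).
- by rewrite (isometry_dot gf).
have cX t : I t -> X (c t) by move=> /cI[].
exists I, (f \o c); split.
  split=> //=; first exact: Cinfty_curve_comp cX.
  - by rewrite c0.
  - by rewrite c1.
move=> t It; have [Xct ct1 ct'] := cI t It; split.
- exact: (fX _ Xct).1.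
- by rewrite (isometry_dot fg).
- by rewrite (isometry_speed fg Io cs cX It).
Qed.

End Isometries.

(** * Complex-valued functions *)

Local Open Scope complex_scope.

Section ComplexParts.
Context {R : realType}.
Implicit Types a b : R[i].

Lemma cReD a b : complex.Re (a + b) = complex.Re a + complex.Re b.
Proof. by case: a; case: b. Qed.
Lemma cImD a b : complex.Im (a + b) = complex.Im a + complex.Im b.
Proof. by case: a; case: b. Qed.
Lemma cReN a : complex.Re (- a) = - complex.Re a. Proof. by case: a. Qed.
Lemma cImN a : complex.Im (- a) = - complex.Im a. Proof. by case: a. Qed.
Lemma cReM a b : complex.Re (a * b) =
  complex.Re a * complex.Re b - complex.Im a * complex.Im b.
Proof. by case: a; case: b. Qed.
Lemma cImM a b : complex.Im (a * b) =
  complex.Re a * complex.Im b + complex.Im a * complex.Re b.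
Proof. by case: a; case: b. Qed.
Lemma cRe_conj a : complex.Re (conjc a) = complex.Re a. Proof. by case: a. Qed.
Lemma cIm_conj a : complex.Im (conjc a) = - complex.Im a. Proof. by case: a. Qed.
Lemma complex_eq a b :
  complex.Re a = complex.Re b -> complex.Im a = complex.Im b -> a = b.
Proof. by case: a b => ? ? [? ?] /= -> ->. Qed.
Lemma conjcM a b : conjc (a * b) = conjc a * conjc b. Proof. exact: rmorphM. Qed.
Lemma conjcX a n : conjc (a ^+ n) = conjc a ^+ n. Proof. exact: rmorphXn. Qed.

Definition cReImE := (cReD, cImD, cReN, cImN, cReM, cImM, cRe_conj, cIm_conj).

Lemma mulcJ a : a * conjc a = (complex.Re a ^+ 2 + complex.Im a ^+ 2)%:C.
Proof. by apply: complex_eq; rewrite !cReImE /=; ring. Qed.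

Lemma mulcJ_eq1 a : a * conjc a = 1 <-> complex.Re a ^+ 2 + complex.Im a ^+ 2 = 1.
Proof.
rewrite mulcJ; split=> [/(congr1 (@complex.Re R))//|->]; exact: complex_eq.
Qed.

End ComplexParts.

Section ComplexSmooth.
Context {R : realType} {V : normedModType R}.
Implicit Types (U : set V) (f g : V -> R[i]) (k : nat).

Definition CkC k U f :=
  Ck k U (fun x => complex.Re (f x)) /\ Ck k U (fun x => complex.Im (f x)).

Lemma CkC_ext k U f g : open U -> (forall x, U x -> f x = g x) ->
  CkC k U f -> CkC k U g.
Proof.
by move=> Uo fg [rf jf]; split;
  [apply: Ck_ext rf => // x /fg ->|apply: Ck_ext jf => // x /fg ->].
Qed.

Lemma CkC_cst k U (a : R[i]) : CkC k U (fun=> a).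
Proof. by split; exact: Ck_cst. Qed.

Lemma CkC_real k U (f : V -> R) : Ck k U f -> CkC k U (fun x => (f x)%:C).
Proof. by split=> //=; exact: Ck_cst. Qed.

Lemma CkCD k U f g : open U -> CkC k U f -> CkC k U g -> CkC k U (fun x => f x + g x).
Proof.
move=> Uo [rf jf] [rg jg]; split.
  by apply: Ck_ext (CkD Uo rf rg) => // x _; rewrite cReD.
by apply: Ck_ext (CkD Uo jf jg) => // x _; rewrite cImD.
Qed.

Lemma CkCM k U f g : open U -> CkC k U f -> CkC k U g -> CkC k U (fun x => f x * g x).
Proof.
move=> Uo [rf jf] [rg jg]; split.
  apply: Ck_ext (CkD Uo (CkM Uo rf rg) (CkN Uo (CkM Uo jf jg))) => // x _.
  by rewrite cReM.
apply: Ck_ext (CkD Uo (CkM Uo rf jg) (CkM Uo jf rg)) => // x _.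
by rewrite cImM.
Qed.

Lemma CkCJ k U f : open U -> CkC k U f -> CkC k U (fun x => conjc (f x)).
Proof.
move=> Uo [rf jf]; split.
  by apply: Ck_ext rf => // x _; rewrite cRe_conj.
by apply: Ck_ext (CkN Uo jf) => // x _; rewrite cIm_conj.
Qed.

Lemma CkCX k U f n : open U -> CkC k U f -> CkC k U (fun x => f x ^+ n).
Proof.
move=> Uo fk; elim: n => [|n IH].
  by apply: CkC_ext (CkC_cst k U 1) => // x _; rewrite expr0.
by apply: CkC_ext (CkCM Uo fk IH) => // x _; rewrite exprS.
Qed.

End ComplexSmooth.

Section ComplexDerive.
Context {R : realType}.
Implicit Types (f g : R -> R[i]) (t : R) (a b : R[i]).

Definition is_deriveC t f a :=
  is_derive t 1 (fun s => complex.Re (f s)) (complex.Re a) /\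
  is_derive t 1 (fun s => complex.Im (f s)) (complex.Im a).

Lemma CkC_is_deriveC (I : set R) f t : CkC 1 I f -> I t ->
  is_deriveC t f ('D_1 (fun s => complex.Re (f s)) t +i*
                  'D_1 (fun s => complex.Im (f s)) t).
Proof.
move=> [rf jf] It; split=> /=; apply/derivableP; apply/derivable1_diffP.
- exact: Ck_differentiable rf It.
- exact: Ck_differentiable jf It.
Qed.

Lemma is_deriveC_real (f : R -> R) t d : is_derive t 1 f d ->
  is_deriveC t (fun s => (f s)%:C) d%:C.
Proof. by split=> //=; exact: is_derive_cst. Qed.

Lemma is_deriveC_cst t a : is_deriveC t (fun=> a) 0.
Proof. by split; exact: is_derive_cst. Qed.

Lemma is_deriveCM t f g a b : is_deriveC t f a -> is_deriveC t g b ->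
  is_deriveC t (fun s => f s * g s) (f t * b + g t * a).
Proof.
move=> [rf jf] [rg jg]; split.
  rewrite (_ : (fun s => _) =
    (fun s => complex.Re (f s)) * (fun s => complex.Re (g s)) -
    (fun s => complex.Im (f s)) * (fun s => complex.Im (g s))); last first.
    by apply/funext => s; rewrite cReM.
  apply: is_derive_eq (is_deriveB (is_deriveM rf rg) (is_deriveM jf jg)) _.
  by rewrite !cReImE /GRing.scale /=; ring.
rewrite (_ : (fun s => _) =
  (fun s => complex.Re (f s)) * (fun s => complex.Im (g s)) +
  (fun s => complex.Im (f s)) * (fun s => complex.Re (g s))); last first.
  by apply/funext => s; rewrite cImM.
apply: is_derive_eq (is_deriveD (is_deriveM rf jg) (is_deriveM jf rg)) _.
by rewrite !cReImE /GRing.scale /=; ring.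
Qed.

Lemma is_deriveCJ t f a : is_deriveC t f a ->
  is_deriveC t (fun s => conjc (f s)) (conjc a).
Proof.
move=> [rf jf]; split.
  by rewrite cRe_conj; under eq_fun do rewrite cRe_conj.
by rewrite cIm_conj; under eq_fun do rewrite cIm_conj; exact: is_deriveN.
Qed.

(* [b] is the logarithmic derivative *)
Lemma is_deriveCX t f b n : is_deriveC t f (b * f t) ->
  is_deriveC t (fun s => f s ^+ n) (n%:R * b * f t ^+ n).
Proof.
move=> df; elim: n => [|n IH].
  by rewrite !mul0r; under eq_fun do rewrite expr0; exact: is_deriveC_cst.
under eq_fun do rewrite exprS.
rewrite (_ : n.+1%:R * _ * _ = f t * (n%:R * b * f t ^+ n) + f t ^+ n * (b * f t)).
  exact: is_deriveCM.
by rewrite exprS -natr1; ring.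
Qed.

Lemma is_deriveC_unique t f a b : is_deriveC t f a -> is_deriveC t f b -> a = b.
Proof.
move=> [[_ ra] [_ ja]] [[_ rb] [_ jb]].
by apply: complex_eq; [rewrite -ra -rb|rewrite -ja -jb].
Qed.

Lemma near_is_deriveC t f g a : (\forall s \near t, f s = g s) ->
  is_deriveC t f a -> is_deriveC t g a.
Proof.
move=> fg [rf jf]; split; first apply: near_eq_is_derive rf.
  by apply: filterS fg => s ->.
by apply: near_eq_is_derive jf; apply: filterS fg => s ->.
Qed.

End ComplexDerive.

(** * The cones *)

Definition o0 : 'I_3 := @Ordinal 3 0 isT.
Definition o1 : 'I_3 := @Ordinal 3 1 isT.
Definition o2 : 'I_3 := @Ordinal 3 2 isT.

Lemma ord3P (P : 'I_3 -> Prop) : P o0 -> P o1 -> P o2 -> forall k, P k.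
Proof.
by move=> P0 P1 P2 [[|[|[|//]]] k3]; [move: P0|move: P1|move: P2];
  congr P; apply/val_inj.
Qed.

Lemma sum3E (V : nmodType) (F : 'I_3 -> V) : \sum_k F k = F o0 + F o1 + F o2.
Proof.
rewrite !big_ord_recl big_ord0 addr0 addrA.
by congr (F _ + F _ + F _); apply/val_inj.
Qed.

Section C3.
Context {R : realType}.
Implicit Types (x : 'rV[R]_(3 + 3)) (z : 'rV[R[i]]_3).

Lemma of_complexK z : to_complex (of_complex z) = z.
Proof.
apply/rowP => k; rewrite mxE row_mxKl row_mxKr !mxE.
by case: (z 0 k).
Qed.

Lemma Re_to_complex x k : complex.Re (to_complex x 0 k) = x 0 (lshift 3 k).
Proof. by rewrite !mxE. Qed.

Lemma Im_to_complex x k : complex.Im (to_complex x 0 k) = x 0 (rshift 3 k).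
Proof. by rewrite !mxE. Qed.

Lemma dot_of_complex z z' : dot (of_complex z) (of_complex z') =
  \sum_k complex.Re (z 0 k * conjc (z' 0 k)).
Proof.
rewrite dotE big_split_ord /= -big_split; apply: eq_bigr => k _ /=.
by rewrite !row_mxEl !row_mxEr !mxE !cReImE; ring.
Qed.

Lemma CkC_to_complex k (U : set 'rV[R]_(3 + 3)) j : open U ->
  CkC k U (fun x => to_complex x 0 j).
Proof.
move=> Uo; split.
  apply: (Ck_ext (f := fun x : 'rV[R]_(3 + 3) => x 0 (lshift 3 j))) => //.
    by move=> x _; rewrite Re_to_complex.
  by apply: Ck_coord => //; exact: Ck_id.
apply: (Ck_ext (f := fun x : 'rV[R]_(3 + 3) => x 0 (rshift 3 j))) => //.
  by move=> x _; rewrite Im_to_complex.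
by apply: Ck_coord => //; exact: Ck_id.
Qed.

Lemma Ck_of_complex (V : normedModType R) k (U : set V) (z : V -> 'rV[R[i]]_3) :
  open U -> (forall j, CkC k U (fun v => z v 0 j)) ->
  Ck k U (fun v => of_complex (z v)).
Proof.
move=> Uo zk; apply: Ck_rV => // i; rewrite -(fintype.splitK i); case: (fintype.split i) => j /=.
  by apply: Ck_ext (zk j).1 => // v _; rewrite row_mxEl !mxE.
by apply: Ck_ext (zk j).2 => // v _; rewrite row_mxEr !mxE.
Qed.

Lemma derive1_of_complex (c : R -> 'rV[R]_(3 + 3)) t z :
  (forall j, is_deriveC t (fun s => to_complex (c s) 0 j) (z 0 j)) ->
  derive1 c t = of_complex z.
Proof.
move=> cz; have dc i : is_derive t 1 (fun s => c s 0 i) (of_complex z 0 i).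
  rewrite -(fintype.splitK i); case: (fintype.split i) => j /=.
    rewrite row_mxEl mxE; under eq_fun do rewrite -Re_to_complex.
    exact: (cz j).1.
  rewrite row_mxEr mxE; under eq_fun do rewrite -Im_to_complex.
  exact: (cz j).2.
rewrite derive1E derive_mx; last first.
  by apply/derivable_mxP => i j; rewrite ord1; exact: ex_derive.
by apply/rowP => i; rewrite mxE; exact: derive_val.
Qed.

End C3.

(** * Parametrization of the punctured cone and its smooth inverse *)

Section Param.
Context {R : realType} (m : nat).
Implicit Types (y w : 'rV[R]_3) (E : R[i]) (k : 'I_3).

Definition weight k : R := [:: m%:R; m.+1%:R; - m.*2.+1%:R]`_k.

(* The factor i on the last coordinate turns the calibrating phase to zero. *)
Definition phase E k : R[i] := [:: E ^+ m; E ^+ m.+1; 'i%C * conjc E ^+ m.*2.+1]`_k.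

Definition param y E : 'rV[R]_(3 + 3) :=
  of_complex (\row_k ((y 0 k)%:C * phase E k)).

Definition quadric y := \sum_k weight k * y 0 k ^+ 2 = 0.

(** The cone without its apex: for positive [m], a zero of the quadratic form with vanishing last
    coordinate is zero, so within [0 <= y 0 o2] the strict inequality removes the apex only. The
    sign selects one of the two nappes of the real quadric. *)
Definition cone0 : set 'rV[R]_(3 + 3) := [set x | exists y E,
  [/\ E * conjc E = 1, quadric y, 0 < y 0 o2 & x = param y E]].

Lemma phase_unit E k : E * conjc E = 1 -> phase E k * conjc (phase E k) = 1.
Proof.
move=> E1; have EX n : E ^+ n * conjc E ^+ n = 1 by rewrite -exprMn E1 expr1n.
move: k; apply: ord3P; rewrite /phase /= ?conjcX ?EX//.
rewrite conjcM conjcX conjcK mulrACA (mulrC (_ ^+ _)) EX mulr1.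
by apply: complex_eq; rewrite !cReImE /=; ring.
Qed.

(** Needed so that [dir] has nonzero modulus on the cone. The quadric equates the positive part of
    the form with a positive multiple of [y 0 o2 ^+ 2], and [m.+1] times the sum of squares
    dominates that positive part. *)
Lemma quadric_gt0 y : quadric y -> 0 < y 0 o2 -> 0 < y 0 o0 ^+ 2 + y 0 o1 ^+ 2.
Proof.
rewrite /quadric sum3E /weight /= => q y2.
have Q : m%:R * y 0 o0 ^+ 2 + m.+1%:R * y 0 o1 ^+ 2 = m.*2.+1%:R * y 0 o2 ^+ 2.
  by apply/eqP; rewrite -subr_eq0 -mulNr; apply/eqP.
have : 0 < m.+1%:R * (y 0 o0 ^+ 2 + y 0 o1 ^+ 2).
  apply: (@lt_le_trans _ _ (m.*2.+1%:R * y 0 o2 ^+ 2)).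
    by rewrite mulr_gt0// exprn_gt0.
  by rewrite -Q mulrDr lerD2r ler_wpM2r ?sqr_ge0// ler_nat.
by rewrite pmulr_rgt0.
Qed.

(** The weights of the two monomials are 2m - (2m+1) = -1 and 2(m+1) - (2m+1) = 1, and [- 'i]
    cancels the constant ['i] in the third phase. After conjugating the first, both are nonnegative
    multiples of [E]. The formula does not involve [m]. *)
Definition dir (z : 'rV[R[i]]_3) : R[i] :=
  (conjc (- 'i%C * z 0 o0 ^+ 2 * z 0 o2)) - 'i%C * z 0 o1 ^+ 2 * z 0 o2.

Lemma dir_param y E : E * conjc E = 1 ->
  dir (\row_k ((y 0 k)%:C * phase E k)) =
  ((y 0 o0 ^+ 2 + y 0 o1 ^+ 2) * y 0 o2)%:C * E.
Proof.
move=> E1; rewrite /dir !mxE /phase /=.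
have EX : E ^+ m * conjc E ^+ m = 1 by rewrite -exprMn E1 expr1n.
have i2 : 'i%C * 'i%C = -1 :> R[i] by rewrite -expr2 sqr_i.
have -> : conjc E ^+ m.*2.+1 = conjc E * conjc E ^+ m * conjc E ^+ m.
  by rewrite exprS -addnn exprD mulrA.
rewrite (exprS E); set u := E ^+ m in EX *; set v := conjc E ^+ m in EX *.
rewrite (_ : - 'i%C * _ * _ = (y 0 o0)%:C ^+ 2 * (y 0 o2)%:C * conjc E); last first.
  transitivity (- ('i%C * 'i%C) * (u * v) ^+ 2 *
    ((y 0 o0)%:C ^+ 2 * (y 0 o2)%:C * conjc E)); first by ring.
  by rewrite i2 EX; ring.
rewrite (_ : 'i%C * _ * _ = - ((y 0 o1)%:C ^+ 2 * (y 0 o2)%:C * E)); last first.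
  transitivity (('i%C * 'i%C) * (u * v) ^+ 2 * (E * conjc E) *
    ((y 0 o1)%:C ^+ 2 * (y 0 o2)%:C * E)); first by ring.
  by rewrite i2 EX E1; ring.
rewrite !expr2 !conjcM !conjc_real conjcK.
by rewrite !rmorphM rmorphD !rmorphM /=; ring.
Qed.

Definition angle x : R[i] := let P := dir (to_complex x) in
  P * ((Num.sqrt (complex.Re P ^+ 2 + complex.Im P ^+ 2))^-1)%:C.

(** Undoes the phases coordinate by coordinate. On the cone the products are already real; taking
    the real part extends the map smoothly to all of [dom]. *)
Definition radial x : 'rV[R]_3 :=
  \row_k complex.Re (to_complex x 0 k * conjc (phase (angle x) k)).

Definition dom : set 'rV[R]_(3 + 3) := [set x |
  0 < complex.Re (dir (to_complex x)) ^+ 2 + complex.Im (dir (to_complex x)) ^+ 2].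

Lemma CkC_dir j (U : set 'rV[R]_(3 + 3)) : open U ->
  CkC j U (fun x => dir (to_complex x)).
Proof.
move=> Uo; have z k := CkC_to_complex j k Uo.
have iC : CkC j U (fun=> 'i%C : R[i]) by exact: CkC_cst.
have NiC : CkC j U (fun=> - 'i%C : R[i]) by exact: CkC_cst.
apply: CkCD => //; first by apply: CkCJ => //; do 2! apply: CkCM => //; exact: CkCX.
apply: (CkC_ext (f := fun x => - 'i%C * (to_complex x) 0 o1 ^+ 2 * to_complex x 0 o2)) => //.
  by move=> x _; rewrite !mulNr.
by do 2! apply: CkCM => //; exact: CkCX.
Qed.

Lemma Ck_dir2 j (U : set 'rV[R]_(3 + 3)) : open U -> Ck j U (fun x =>
  complex.Re (dir (to_complex x)) ^+ 2 + complex.Im (dir (to_complex x)) ^+ 2).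
Proof.
by move=> Uo; have [rd jd] := CkC_dir j Uo; apply: CkD => //; exact: CkX.
Qed.

Lemma dom_open : open dom.
Proof.
have c : continuous (fun x : 'rV[R]_(3 + 3) =>
    complex.Re (dir (to_complex x)) ^+ 2 + complex.Im (dir (to_complex x)) ^+ 2).
  by move=> x; exact: (Ck_dir2 0 openT x Logic.I).
by have := @open_comp _ _ _ _ (fun x _ => c x) (@open_gt _ 0).
Qed.

Lemma CkC_angle j : CkC j dom angle.
Proof.
have Do := dom_open; apply: CkCM => //; first exact: CkC_dir.
apply: CkC_real; apply: CkV => // [x xD|]; first by rewrite gt_eqF// sqrtr_gt0.
by apply: Ck_sqrt => //; exact: Ck_dir2.
Qed.

Lemma CkC_phase (V : normedModType R) j (U : set V) (E : V -> R[i]) k :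
  open U -> CkC j U E -> CkC j U (fun v => phase (E v) k).
Proof.
move=> Uo Ej; move: k; apply: ord3P; rewrite /phase /=.
- exact: CkCX.
- exact: CkCX.
- by apply: CkCM => //; [exact: CkC_cst|apply: CkCX => //; exact: CkCJ].
Qed.

Lemma Ck_radial j k : Ck j dom (fun x => radial x 0 k).
Proof.
have Do := dom_open.
have [rz _] : CkC j dom (fun x => to_complex x 0 k * conjc (phase (angle x) k)).
  apply: CkCM => //; first exact: CkC_to_complex.
  by apply: CkCJ => //; apply: CkC_phase => //; exact: CkC_angle.
by apply: Ck_ext rz => // x _; rewrite [RHS]mxE.
Qed.

Lemma Ck_param (V : normedModType R) j (U : set V) (y : V -> 'rV[R]_3) (E : V -> R[i]) :
  open U -> (forall k, Ck j U (fun v => y v 0 k)) -> CkC j U E ->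
  Ck j U (fun v => param (y v) (E v)).
Proof.
move=> Uo yj Ej; apply: Ck_of_complex => // k.
apply: (CkC_ext (f := fun v => (y v 0 k)%:C * phase (E v) k)) => //.
  by move=> v _; rewrite mxE.
by apply: CkCM => //; [exact: CkC_real|exact: CkC_phase].
Qed.

Section OnCone.
Variables (y : 'rV[R]_3) (E : R[i]).
Hypotheses (E1 : E * conjc E = 1) (yq : quadric y) (y2 : 0 < y 0 o2).

Let r_gt0 : 0 < (y 0 o0 ^+ 2 + y 0 o1 ^+ 2) * y 0 o2.
Proof. by rewrite mulr_gt0// quadric_gt0. Qed.

Let dirE : dir (to_complex (param y E)) =
  ((y 0 o0 ^+ 2 + y 0 o1 ^+ 2) * y 0 o2)%:C * E.
Proof. by rewrite of_complexK dir_param. Qed.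

Let dir2 : complex.Re (dir (to_complex (param y E))) ^+ 2 +
  complex.Im (dir (to_complex (param y E))) ^+ 2 =
  ((y 0 o0 ^+ 2 + y 0 o1 ^+ 2) * y 0 o2) ^+ 2.
Proof.
have /mulcJ_eq1 e := E1; rewrite dirE.
set r := _ * y 0 o2; transitivity (r ^+ 2 * (complex.Re E ^+ 2 + complex.Im E ^+ 2)).
  by rewrite !cReImE /=; ring.
by rewrite e mulr1.
Qed.

Lemma dom_param : dom (param y E).
Proof. by rewrite /dom /= dir2 exprn_gt0. Qed.

Lemma angle_param : angle (param y E) = E.
Proof.
rewrite /angle dir2 dirE sqrtr_sqr gtr0_norm// mulrAC -rmorphM /= divff ?gt_eqF//.
by rewrite mul1r.
Qed.

Lemma radial_param : radial (param y E) = y.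
Proof.
apply/rowP => k; rewrite mxE angle_param of_complexK mxE -mulrA phase_unit//.
by rewrite mulr1.
Qed.

End OnCone.

Lemma cone0_dom : cone0 `<=` dom.
Proof. by move=> x [y [E [E1 yq y2 ->]]]; exact: dom_param. Qed.

Lemma cone0E x : cone0 x ->
  [/\ angle x * conjc (angle x) = 1, quadric (radial x), 0 < radial x 0 o2 &
      param (radial x) (angle x) = x].
Proof.
move=> [y [E [E1 yq y2 ->]]].
by rewrite (radial_param E1 yq y2) (angle_param E1 yq y2).
Qed.

Lemma dot_param y E : E * conjc E = 1 -> dot (param y E) (param y E) = \sum_k y 0 k ^+ 2.
Proof.
move=> E1; rewrite dot_of_complex; apply: eq_bigr => k _.
rewrite mxE conjcM mulrACA phase_unit// mulr1 conjc_real -rmorphM /=.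
by rewrite expr2.
Qed.

Lemma param_scale s y E : s *: param y E = param (s *: y) E.
Proof.
rewrite /param /of_complex scale_row_mx; congr row_mx; apply/rowP => k.
  by rewrite !mxE !cReM /=; ring.
by rewrite !mxE !cImM /=; ring.
Qed.

Lemma quadric_scale s y : quadric y -> quadric (s *: y).
Proof.
rewrite /quadric => q; under eq_bigr do rewrite mxE exprMn mulrCA.
by rewrite -mulr_sumr q mulr0.
Qed.

Lemma cone0_scale s x : 0 < s -> cone0 x -> cone0 (s *: x).
Proof.
move=> s0 [y [E [E1 yq y2 ->]]]; exists (s *: y), E; split=> //.
- exact: quadric_scale.
- by rewrite mxE mulr_gt0.
- by rewrite param_scale.
Qed.

Lemma cone0_neq0 : ~ cone0 0.
Proof.
move=> /cone0_dom; rewrite /dom /= /dir.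
have z0 k : to_complex (0 : 'rV[R]_(3 + 3)) 0 k = 0.
  by apply: complex_eq; rewrite !mxE.
by rewrite !z0 !mulr0 conjc0 subr0 /= expr0n addr0 ltxx.
Qed.

End Param.

(** * Velocities of curves in the cone *)

Section Velocity.
Context {R : realType} (m : nat).
Implicit Types (c : R -> 'rV[R]_(3 + 3)) (t : R) (E : R[i]) (k : 'I_3).

Lemma is_deriveC_phase (e : R -> R[i]) t (om : R) k :
  is_deriveC t e ('i%C * om%:C * e t) ->
  is_deriveC t (fun s => phase m (e s) k)
    ('i%C * (om * weight m k)%:C * phase m (e t) k).
Proof.
move=> de; have cde : is_deriveC t (fun s => conjc (e s)) (- ('i%C * om%:C) * conjc (e t)).
  rewrite (_ : - _ * _ = conjc ('i%C * om%:C * e t)); first exact: is_deriveCJ.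
  rewrite !conjcM conjc_real (_ : conjc 'i%C = - 'i%C) ?mulNr//.
  by apply: complex_eq => /=; rewrite ?oppr0.
move: k; apply: ord3P; rewrite /phase /weight /= rmorphM /= ?rmorphN /= rmorph_nat.
- rewrite (_ : 'i%C * _ * _ = m%:R * ('i%C * om%:C) * e t ^+ m); last by ring.
  exact: is_deriveCX.
- rewrite (_ : 'i%C * _ * _ = m.+1%:R * ('i%C * om%:C) * e t ^+ m.+1); last by ring.
  exact: is_deriveCX.
- have := is_deriveCM (is_deriveC_cst t 'i%C) (is_deriveCX (m.*2.+1) cde).
  by congr (is_deriveC _ _ _); ring.
Qed.

(** Differentiating [e * conjc e = 1] shows that [a * conjc (e t)] is purely imaginary; its
    imaginary part is the angular speed. *)
Lemma unit_deriveC (e : R -> R[i]) t a : (\forall s \near t, e s * conjc (e s) = 1) ->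
  is_deriveC t e a -> a = 'i%C * (complex.Im (a * conjc (e t)))%:C * e t.
Proof.
move=> e1 da; have et := nbhs_singleton e1.
have D0 : e t * conjc a + conjc (e t) * a = 0.
  apply: is_deriveC_unique (is_deriveCM da (is_deriveCJ da)) _.
  apply: near_is_deriveC (is_deriveC_cst t 1).
  by apply: filterS e1 => s ->.
have Re0 : complex.Re (a * conjc (e t)) = 0.
  have := congr1 (@complex.Re R) D0; rewrite !cReImE /= => H; lra.
have -> : 'i%C * (complex.Im (a * conjc (e t)))%:C = a * conjc (e t).
  by apply: complex_eq; rewrite cReImE /= ?Re0; ring.
by rewrite -mulrA (mulrC (conjc _)) et mulr1.
Qed.

(** Along the curve [radial] and [angle] are smooth in time and [param] rebuilds the curve from
    them, so the product rule gives the velocity, [w] being the radial and [om] the angular rate.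
    Differentiating the quadric equation gives twice the orthogonality relation. *)
Lemma cone0_velocity (I : set R) c t : open I -> Cinfty I c ->
  (forall s, I s -> cone0 m (c s)) -> I t ->
  exists (w : 'rV[R]_3) (om : R),
  [/\ \sum_k weight m k * radial m (c t) 0 k * w 0 k = 0,
      forall k, is_derive t 1 (fun s => radial m (c s) 0 k) (w 0 k),
      is_deriveC t (fun s => angle (c s)) ('i%C * om%:C * angle (c t)) &
      derive1 c t = of_complex (\row_k
        (((w 0 k)%:C + 'i%C * (om * (weight m k * radial m (c t) 0 k))%:C) *
         phase m (angle (c t)) k))].
Proof.
move=> Io cs cX It.
have It' : \forall s \near t, I s by exact: open_nbhs_nbhs.
have cD s : I s -> dom (c s) by move=> /cX /cone0_dom.
have fk k : Ck 1 I (fun s => radial m (c s) 0 k).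
  exact: (Ck_comp1 Io cD (cs 1%N) (Ck_radial m 1 k)).
have ek : CkC 1 I (fun s => angle (c s)).
  have [ra ja] := @CkC_angle R 1.
  by split; [exact: (Ck_comp1 Io cD (cs 1%N) ra)|exact: (Ck_comp1 Io cD (cs 1%N) ja)].
pose w : 'rV[R]_3 := \row_k 'D_1 (fun s => radial m (c s) 0 k) t.
have fw k : is_derive t 1 (fun s => radial m (c s) 0 k) (w 0 k).
  rewrite mxE; apply/derivableP; apply/derivable1_diffP.
  exact: Ck_differentiable (fk k) It.
have de := CkC_is_deriveC ek It.
have e1 : \forall s \near t, angle (c s) * conjc (angle (c s)) = 1.
  by apply: filterS It' => s /cX /(@cone0E R m)[].
have Ee := unit_deriveC e1 de; rewrite {}Ee in de.
set om := complex.Im _ in de.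
exists w, om; split=> //.
  pose h k : R -> R := weight m k *:
    ((fun s => radial m (c s) 0 k) * (fun s => radial m (c s) 0 k)).
  have dh k : is_derive t 1 (h k) (weight m k *:
    (radial m (c t) 0 k *: w 0 k + radial m (c t) 0 k *: w 0 k)).
    by apply: is_deriveZ; exact: is_deriveM.
  have [_ dS] := is_derive_sum dh.
  have : 'D_1 (\sum_k h k) t = 'D_1 (cst 0 : R -> R) t.
    apply: near_eq_derive; apply: filterS It' => s /cX /(@cone0E R m)[_ q _ _].
    by rewrite fct_sumE /= -[RHS]q; apply: eq_bigr => k _; rewrite expr2.
  rewrite dS derive_cst => S0.
  have : 2 * \sum_k weight m k * radial m (c t) 0 k * w 0 k = 0.
    rewrite -[RHS]S0 mulr_sumr; apply: eq_bigr => k _.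
    by rewrite /GRing.scale /=; ring.
  by move/eqP; rewrite mulf_eq0 pnatr_eq0 /= => /eqP.
apply: derive1_of_complex => j; rewrite mxE.
have := is_deriveCM (is_deriveC_real (fw j)) (is_deriveC_phase j de).
rewrite (_ : _ + _ = ((w 0 j)%:C + 'i%C * (om * (weight m j * radial m (c t) 0 j))%:C) *
         phase m (angle (c t)) j); last by rewrite !rmorphM /=; ring.
apply: near_is_deriveC; apply: filterS It' => s /cX /(@cone0E R m)[_ _ _ cE].
transitivity (to_complex (param m (radial m (c s)) (angle (c s))) 0 j).
  by rewrite /param of_complexK [RHS]mxE.
by rewrite cE.
Qed.

End Velocity.

(** * Orientation and calibration *)

Lemma det3E (A : comNzRingType) (M : 'M[A]_3) : \det M =
  M o0 o0 * (M o1 o1 * M o2 o2 - M o1 o2 * M o2 o1)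
  - M o0 o1 * (M o1 o0 * M o2 o2 - M o1 o2 * M o2 o0)
  + M o0 o2 * (M o1 o0 * M o2 o1 - M o1 o1 * M o2 o0).
Proof.
rewrite (expand_det_row _ ord0) !big_ord_recl big_ord0 /cofactor.
rewrite !(expand_det_row _ ord0) !big_ord_recl !big_ord0 /cofactor.
rewrite !det_mx11 !mxE /=.
(* Indexing entries by naturals lets the nested lifts compute to numerals, so that [ring] recognises
   equal entries. *)
pose h (i j : nat) := M (inord i) (inord j).
have hE i j : M i j = h i j by rewrite /h !inord_val.
rewrite !hE /bump /=; ring.
Qed.

Section Gram.
Context {R : realType}.

Lemma row_freeP0 p q (A : 'M[R]_(p, q)) :
  (forall u : 'rV_p, u *m A = 0 -> u = 0) -> row_free A.
Proof.
move=> H; rewrite -kermx_eq0; apply/eqP/row_matrixP => i; rewrite row0.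
by apply: H; rewrite -row_mul mulmx_ker row0.
Qed.

(** A vector [u] killed by the Gram matrix makes [u *m A] of length zero, hence [u] zero by
    freeness. *)
Lemma gram_det_neq0 p q (A : 'M[R]_(p, q)) : row_free A -> \det (A *m A^T) != 0.
Proof.
move=> Af; rewrite -unitfE -unitmxE -row_free_unit; apply: row_freeP0 => u uA.
apply/eqP; rewrite -(mulmx_free_eq0 _ Af) -dot_eq0 /dot trmx_mul.
by rewrite mulmxA -(mulmxA u) uA mul0mx mxE.
Qed.

Lemma mulmx_trE p q (A : 'M[R]_(p, q)) i j :
  (A *m A^T) i j = dot (row i A) (row j A).
Proof. by rewrite dotE mxE; apply: eq_bigr => k _; rewrite !mxE. Qed.

(* With n orthogonal to the rows of W, the complex matrix W + i om n has
   determinant i det B for the real matrix B = W + om n, and B has the same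
   Gram matrix as E. *)
Lemma ReOmega_gram (W : 'M[R]_3) (om : 'cV[R]_3) (n : 'rV[R]_3)
    (ph : 'I_3 -> R[i]) (E : 'M[R]_(3, 3 + 3)) :
  n != 0 -> (forall i, \sum_k n 0 k * W i k = 0) ->
  (forall k, ph k * conjc (ph k) = 1) -> ph o0 * ph o1 * ph o2 = 'i%C ->
  (forall i, row i E = of_complex (\row_k
     (((W i k)%:C + 'i%C * (om i 0 * n 0 k)%:C) * ph k))) ->
  ReOmega E ^+ 2 = \det (E *m E^T).
Proof.
move=> n0 Wn ph1 phi rE; pose B := W + om *m n.
have BE i k : B i k = W i k + om i 0 * n 0 k.
  by rewrite mxE [in X in _ + X]mxE big_ord1.
have gram : E *m E^T = B *m B^T.
  apply/matrixP => i j; rewrite !mulmx_trE !rE dot_of_complex dotE.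
  (* The real products of the rows of [B] differ from those of [E] only by the mixed terms in [W]
     and [n], which orthogonality kills. *)
  transitivity (\sum_k (B i k * B j k) - om j 0 * (\sum_k n 0 k * W i k)
    - om i 0 * (\sum_k n 0 k * W j k)).
    rewrite !mulr_sumr -!sumrB; apply: eq_bigr => k _; rewrite !BE !mxE.
    rewrite !conjcM mulrACA ph1 mulr1 !cReImE /=; ring.
  by rewrite !Wn !mulr0 !subr0; apply: eq_bigr => k _; rewrite !mxE.
(* The nonzero vector [n] lies in the kernel of [W]. *)
have detW : \det W = 0.
  apply/eqP; apply: contraNT n0 => dW; rewrite -(inj_eq trmx_inj) trmx0.
  have Wn0 : W *m n^T = 0.
    apply/colP => i; rewrite !mxE -[RHS](Wn i); apply: eq_bigr => k _.
    by rewrite !mxE mulrC.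
  have Wu : W \in unitmx by rewrite unitmxE unitfE.
  by rewrite -[n^T](mulKmx Wu) Wn0 mulmx0.
rewrite gram det_mulmx det_tr -expr2 /ReOmega.
(* Since [om *m n] has rank at most one, det(W + s om n) is affine in s; its values at s = 0 and s =
   1 determine the one at s = i. The phases contribute one more factor i, so the real part is
   [- \det B]. *)
suff -> : \det (\matrix_(j < 3) to_complex (row j E)) =
    ((\det W)%:C + 'i%C * (\det B - \det W)%:C) * (ph o0 * ph o1 * ph o2).
  by rewrite phi detW !cReImE /=; ring.
have zE i k : (\matrix_(j < 3) to_complex (row j E)) i k =
    ((W i k)%:C + 'i%C * (om i 0 * n 0 k)%:C) * ph k.
  by rewrite mxE rE of_complexK mxE.
by rewrite !det3E !zE !BE !(rmorphD, rmorphB, rmorphM) /=; ring.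
Qed.

Lemma ReOmegaM (A : 'M[R]_3) (E : 'M[R]_(3, 3 + 3)) :
  ReOmega (A *m E) = \det A * ReOmega E.
Proof.
rewrite /ReOmega; set Z := \matrix_j to_complex (row j E).
have -> : \matrix_j to_complex (row j (A *m E)) = map_mx (real_complex R) A *m Z.
  apply/matrixP => i k; rewrite mxE [RHS]mxE.
  apply: complex_eq.
    rewrite Re_to_complex mxE mxE (raddf_sum (@complex.Re R : Rcomplex R -> R)).
    by apply: eq_bigr => j _ /=; rewrite [in RHS]mxE !cReImE /= mxE Re_to_complex mxE; ring.
  rewrite Im_to_complex mxE mxE (raddf_sum (@complex.Im R : Rcomplex R -> R)).
  by apply: eq_bigr => j _ /=; rewrite [in RHS]mxE !cReImE /= mxE Im_to_complex mxE; ring.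
by rewrite det_mulmx det_map_mx cReM /= mul0r subr0.
Qed.

Lemma ReOmega_continuous : continuous (@ReOmega R).
Proof.
pose Z (E : 'M[R]_(3, 3 + 3)) i k := to_complex (row i E) 0 k.
have cZ i k : CkC 0 setT (fun E => Z E i k).
  have co p q : continuous (fun E : 'M[R]_(3, 3 + 3) => E p q).
    by move=> E; exact: coord_continuous.
  split=> E _.
    by rewrite (_ : (fun _ => _) = fun E : 'M[R]_(3, 3 + 3) => E i (lshift 3 k));
      [exact: co|apply/funext => F; rewrite Re_to_complex mxE].
  by rewrite (_ : (fun _ => _) = fun E : 'M[R]_(3, 3 + 3) => E i (rshift 3 k));
    [exact: co|apply/funext => F; rewrite Im_to_complex mxE].
have oT := @openT ('M[R]_(3, 3 + 3) : topologicalType).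
have cN f : CkC 0 setT f -> CkC 0 setT (fun E : 'M[R]_(3, 3 + 3) => - f E).
  move=> [rf jf]; split.
    by apply: (Ck_ext oT _ (CkN oT rf)) => E _; rewrite cReN.
  by apply: (Ck_ext oT _ (CkN oT jf)) => E _; rewrite cImN.
have T a b c d e f g h p q : CkC 0 setT
    (fun E => Z E a b * (Z E c d * Z E e f - Z E g h * Z E p q)).
  apply: CkCM => //; apply: (CkCD oT (f := fun E => Z E c d * Z E e f)).
    exact: CkCM.
  by apply: (cN (fun E => Z E g h * Z E p q)); exact: CkCM.
have D := CkCD oT (CkCD oT (T o0 o0 o1 o1 o2 o2 o1 o2 o2 o1)
  (cN _ (T o0 o1 o1 o0 o2 o2 o1 o2 o2 o0))) (T o0 o2 o1 o0 o2 o1 o1 o1 o2 o0).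
have [rD _] : CkC 0 setT (fun E : 'M[R]_(3, 3 + 3) =>
    \det (\matrix_(j < 3) to_complex (row j E))).
  apply: CkC_ext D => // E _; rewrite det3E.
  have zE i k : (\matrix_(j < 3) to_complex (row j E)) i k = Z E i k by rewrite [LHS]mxE.
  by rewrite !zE.
by move=> E; exact: (rD E Logic.I).
Qed.

End Gram.

Section Orientation.
Context {R : realType}.

Lemma near_within_sign n (X U : set 'rV[R]_n) x (E : 'rV[R]_n -> 'M[R]_(3, 3 + 3)) :
  X x -> open_nbhs x U ->
  ReOmega (E y) @[y --> within (X `&` U) (nbhs x)] --> ReOmega (E x) ->
  (forall y, X y -> U y -> ReOmega (E y) != 0) ->
  \forall y \near x, X y -> (0 < ReOmega (E y) <-> 0 < ReOmega (E x)).
Proof.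
move=> Xx [Uo Ux] cE E0.
have nU : \forall y \near x, U y by exact: open_nbhs_nbhs.
have [Ex|Ex|Ex] := ltgtP 0 (ReOmega (E x)).
- have : \forall y \near within (X `&` U) (nbhs x), 0 < ReOmega (E y).
    by apply: (cE [set r | 0 < r]); exact: open_nbhs_nbhs (conj (@open_gt _ 0) Ex).
  rewrite /within /= => H; apply: filterS2 nU H => y Uy Hy Xy.
  by split=> // _; exact: Hy.
- have : \forall y \near within (X `&` U) (nbhs x), ReOmega (E y) < 0.
    by apply: (cE [set r | r < 0]); exact: open_nbhs_nbhs (conj (@open_lt _ 0) Ex).
  rewrite /within /= => H; apply: filterS2 nU H => y Uy Hy Xy.
  split=> // y0; have := lt_trans y0 (Hy (conj Xy Uy)).
  by rewrite ltxx.
- by have := E0 x Xx Ux; rewrite -Ex eqxx.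
Qed.

(** The Gram determinant of a frame is nonzero, so by hypothesis [ReOmega] never vanishes on frames
    and its sign can itself serve as orientation. With this choice, calibration reduces to taking
    the positive square root. *)
Lemma ReOmega_orientation (X : set 'rV[R]_(3 + 3)) :
  (forall x E, X x -> frame X x E -> ReOmega E ^+ 2 = \det (E *m E^T)) ->
  orientation X (fun _ (E : 'M[R]_(3, 3 + 3)) => 0 < ReOmega E).
Proof.
move=> XE; have E0 x E : X x -> frame X x E -> ReOmega E != 0.
  move=> Xx fE; rewrite -sqrf_eq0 (XE x)//; apply: gram_det_neq0.
  by case: fE.
split=> [x E A Xx /(E0 x _ Xx) e0|x U E Xx xU cE fE].
  rewrite ReOmegaM; split=> dA; first by rewrite pmulr_rgt0.
  rewrite nmulr_rgt0//; split=> [e1|/negP]; first by apply/negP; rewrite -leNgt ltW.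
  by rewrite -leNgt le_eqVlt (negbTE e0).
apply: (near_within_sign Xx xU) => //; last by move=> y Xy /(fE y Xy); exact: E0.
have Exc := (@subspace_continuousP _ _ _ _).1 cE x (conj Xx xU.2).
exact: continuous_cvg (@ReOmega_continuous R (E x)) Exc.
Qed.

Lemma ReOmega_calibrated (X : set 'rV[R]_(3 + 3)) :
  (forall x E, X x -> frame X x E -> ReOmega E ^+ 2 = \det (E *m E^T)) ->
  calibrated ReOmega X.
Proof.
move=> XE; eexists; first exact: ReOmega_orientation.
by move=> x E Xx fE o; rewrite -(XE x)// sqrtr_sqr gtr0_norm.
Qed.

(** Each row of a frame is a velocity in the normal form of [cone0_velocity], with the same [n] and
    phases for all three rows; [n] is nonzero because its last coordinate is. *)
Lemma cone0_frame m x (E : 'M[R]_(3, 3 + 3)) : cone0 m x ->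
  frame (cone0 m) x E -> ReOmega E ^+ 2 = \det (E *m E^T).
Proof.
move=> Xx [_ tE]; have [A1 q y2 xE] := cone0E Xx.
pose n : 'rV[R]_3 := \row_k (weight m k * radial m x 0 k).
have H (i : 'I_3) : exists wo : 'rV[R]_3 * R,
    \sum_k n 0 k * wo.1 0 k = 0 /\
    row i E = of_complex (\row_k
      (((wo.1 0 k)%:C + 'i%C * (wo.2 * n 0 k)%:C) * phase m (angle x) k)).
  have [c [c0 [I [[Io I0] cs cX]]] <-] := tE i.
  have [w [om [wn _ _ ->]]] := cone0_velocity Io cs cX I0.
  rewrite c0 in wn *; exists (w, om); split=> /=.
    by rewrite -[RHS]wn; apply: eq_bigr => k _; rewrite mxE.
  by congr of_complex; apply/rowP => k; rewrite !mxE.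
have [wo Hwo] := choice H.
apply: (@ReOmega_gram R (\matrix_(i, k) (wo i).1 0 k) (\col_i (wo i).2) n
  (phase m (angle x))).
- apply/eqP => /rowP/(_ o2); rewrite [LHS]mxE [RHS]mxE /weight /= => /eqP.
  by rewrite mulf_eq0 oppr_eq0 pnatr_eq0 /= gt_eqF.
- move=> i; rewrite -[RHS](Hwo i).1; apply: eq_bigr => k _.
  by congr (_ * _); rewrite mxE.
- by move=> k; exact: phase_unit.
(* The weights sum to zero, so the powers of the angle cancel and only the constant ['i] is left. *)
- rewrite /phase /=; have -> : conjc (angle x) ^+ m.*2.+1 =
      conjc (angle x) * conjc (angle x) ^+ m * conjc (angle x) ^+ m.
    by rewrite exprS -addnn exprD mulrA.
  have EX : angle x ^+ m * conjc (angle x) ^+ m = 1 by rewrite -exprMn A1 expr1n.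
  rewrite (exprS (angle x)).
  set u := angle x ^+ m in EX *; set v := conjc (angle x) ^+ m in EX *.
  transitivity ('i%C * (u * v) ^+ 2 * (angle x * conjc (angle x))); first by ring.
  by rewrite EX A1; ring.
- move=> i; rewrite (Hwo i).2; congr of_complex; apply/rowP => k.
  have e1 : (\matrix_(i, k) (wo i).1 0 k) i k = (wo i).1 0 k by rewrite mxE.
  have e2 : (\col_i (wo i).2) i 0 = (wo i).2 by rewrite mxE.
  by rewrite [LHS]mxE [RHS]mxE e1 e2.
Qed.

Definition clink m : set 'rV[R]_(3 + 3) := cone0 m `&` unit_sphere.

Lemma tangent_sub n (X Y : set 'rV[R]_n) x v : X `<=` Y -> tangent X x v -> tangent Y x v.
Proof.
move=> XY [c [c0 [I [I0 cs cX]]] c']; exists c => //; split=> //.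
by exists I; split=> // t /cX /XY.
Qed.

Lemma cone0_tangent_radial m (x : 'rV[R]_(3 + 3)) : cone0 m x -> tangent (cone0 m) x x.
Proof.
move=> Xx; exists (fun s => (1 + s) *: x).
  split; first by rewrite addr0 scale1r.
  exists [set s | -1 < s]; split.
  - by split; [exact: open_gt|rewrite /= ltrN10].
  - move=> k; apply: CkZl; first exact: open_gt.
    by apply: CkD; [exact: open_gt|exact: Ck_cst|exact: Ck_id].
  - by move=> s /= s1; apply: cone0_scale => //; rewrite -ltrBlDl sub0r.
have dk : Ck 1 setT (fun s : R => 1 + s).
  by apply: CkD; [exact: openT|exact: Ck_cst|exact: Ck_id].
have d0 : differentiable (fun s : R => 1 + s) 0 by exact: (Ck_differentiable (U := setT) dk).
rewrite derive1E deriveE; last first.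
  have dx := CkZl x openT dk.
  exact: (Ck_differentiable (U := setT) dx).
rewrite (diffZl x d0) -deriveE//.
have -> : 'D_(1 : R) (fun s : R => 1 + s) 0 = 1.
  have e : is_derive (0 : R) (1 : R) (cst (1 : R) + id) (0 + 1) by exact: is_deriveD.
  by rewrite (_ : (fun s : R => 1 + s) = cst 1 + id)// (@derive_val _ _ _ _ _ _ _ e) add0r.
by rewrite scale1r.
Qed.

Lemma unit_tangent_orthogonal n (X : set 'rV[R]_n) x v : X `<=` unit_sphere ->
  tangent X x v -> dot v x = 0.
Proof.
move=> XS [c [c0 [I [[Io I0] cs cX]]] <-].
have dc : derivable c 0 1.
  by apply/derivable1_diffP; exact: Ck_differentiable (cs 1%N) I0.
pose h (i : 'I_n) : R -> R := (fun s => c s 0 i) * (fun s => c s 0 i).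
have dci i : is_derive (0 : R) (1 : R) (fun s => c s 0 i) (derive1 c 0 0 i).
  rewrite derive1E derive_mx// mxE; apply/derivableP.
  by have /derivable_mxP := dc; exact.
have dh i : is_derive (0 : R) (1 : R) (h i) (c 0 0 i *: derive1 c 0 0 i + c 0 0 i *: derive1 c 0 0 i).
  exact: is_deriveM.
have [_ dS] := is_derive_sum dh.
have : 'D_1 (\sum_i h i) 0 = 'D_1 (cst 1 : R -> R) 0.
  apply: near_eq_derive; apply: filterS (open_nbhs_nbhs (conj Io I0)) => s /cX /XS.
  rewrite fct_sumE /unit_sphere /= dotE => <-.
  by apply: eq_bigr.
rewrite dS derive_cst => S0.
have : 2 * dot (derive1 c 0) x = 0.
  rewrite -[RHS]S0 dotE mulr_sumr -c0; apply: eq_bigr => i _.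
  by rewrite /GRing.scale /=; ring.
by move/eqP; rewrite mulf_eq0 pnatr_eq0 /= => /eqP.
Qed.

(** Tangent vectors of the link are orthogonal to the position vector, which is itself tangent to
    the cone; hence adjoining it keeps the rows independent. *)
Lemma clink_frame m x (E : 'M[R]_(2, 3 + 3)) : clink m x -> frame (clink m) x E ->
  frame (cone0 m) x (col_mx x E : 'M[R]_(1 + 2, 3 + 3)).
Proof.
move=> [Xx x1] [Ef tE]; split; last first.
  move=> i; rewrite -(fintype.splitK i); case: (fintype.split i) => j /=.
    rewrite rowKu; rewrite row_id ?ord1//; exact: cone0_tangent_radial.
  by rewrite rowKd; apply: tangent_sub (tE j) => y [].
have xE : E *m x^T = 0.
  apply/colP => i; rewrite [RHS]mxE -[RHS](unit_tangent_orthogonal _ (tE i)); last by move=> y [].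
  by rewrite dotE mxE; apply: eq_bigr => k _; rewrite !mxE.
apply: row_freeP0 => u; rewrite -[u]hsubmxK mul_row_col => u0.
have l0 : lsubmx u = 0.
  have : (lsubmx u *m x + rsubmx u *m E) *m x^T = 0 by rewrite u0 mul0mx.
  rewrite mulmxDl -!mulmxA xE mulmx0 addr0.
  have -> : x *m x^T = 1%:M.
    by apply/matrixP => i j; rewrite !ord1 [RHS]mxE; exact: x1.
  by rewrite mulmx1.
move: u0; rewrite l0 mul0mx add0r => /eqP; rewrite mulmx_free_eq0// => /eqP ->.
exact: row_mx0.
Qed.

Lemma norm_col_mx_lt p q n (A : 'M[R]_(p, n)) (B : 'M[R]_(q, n)) e : 0 < e ->
  `|A| < e -> `|B| < e -> `|col_mx A B| < e.
Proof.
have ent p' q' (M : 'M[R]_(p', q')) i j : `|M i j| <= `|M|.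
  by rewrite [leRHS]mx_normrE; exact: (le_bigmax _ _ (i, j)).
move=> e0 Ae Be; rewrite [ltLHS]mx_normrE; apply: bigmax_lt => // -[i j] _ /=.
rewrite -(fintype.splitK i); case: (fintype.split i) => k /=.
  by rewrite col_mxEu; exact: le_lt_trans (ent _ _ _ _ _) Ae.
by rewrite col_mxEd; exact: le_lt_trans (ent _ _ _ _ _) Be.
Qed.

(** Boundary orientation: a frame of the link is positive when the outward radial vector followed by
    it is positive for the cone. *)
Lemma clink_orientable m : orientable 2 (clink m).
Proof.
exists (fun x (E : 'M[R]_(2, 3 + 3)) =>
  0 < ReOmega (col_mx x E : 'M[R]_(1 + 2, 3 + 3))).
have E0 x (E : 'M[R]_(2, 3 + 3)) : clink m x -> frame (clink m) x E ->
    ReOmega (col_mx x E : 'M[R]_(1 + 2, 3 + 3)) != 0.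
  move=> Xx /(clink_frame Xx) fE; rewrite -sqrf_eq0 (cone0_frame Xx.1 fE).
  by apply: gram_det_neq0; case: fE.
split=> [x E A Xx /(E0 x _ Xx) e0|x U E Xx xU cE fE].
  have -> : ReOmega (col_mx x (A *m E) : 'M[R]_(1 + 2, 3 + 3)) =
      \det A * ReOmega (col_mx x E : 'M[R]_(1 + 2, 3 + 3)).
    (* A change of basis in the link fixes the radial row, so on the cone it is block diagonal with
       the same determinant. *)
    have -> : col_mx x (A *m E) = block_mx (1%:M : 'M[R]_1) 0 0 A *m col_mx x E.
      by rewrite mul_block_col !mul0mx mul1mx add0r addr0.
    rewrite (ReOmegaM (block_mx (1%:M : 'M[R]_1) 0 0 A : 'M[R]_(1 + 2))).
    by rewrite (det_ublock (1%:M : 'M[R]_1)) det1 mul1r.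
  split=> dA; first by rewrite pmulr_rgt0.
  rewrite nmulr_rgt0//; split=> [e1|/negP]; first by apply/negP; rewrite -leNgt ltW.
  by rewrite -leNgt le_eqVlt (negbTE e0).
apply: (near_within_sign (E := fun y => col_mx y (E y)) Xx xU) => //;
  last by move=> y Xy /(fE y Xy); exact: E0.
have Exc := (@subspace_continuousP _ _ _ _).1 cE x (conj Xx xU.2).
apply: continuous_cvg (@ReOmega_continuous R (col_mx x (E x) : 'M[R]_(1 + 2, 3 + 3))) _.
apply/cvgrPdist_lt => e e0.
have Ee : \forall y \near x, (clink m `&` U) y -> `|E x - E y| < e.
  exact: (cvgrPdist_lt _ _).1 Exc e e0.
have xe : \forall y \near x, `|x - y| < e.
  by apply: filterS (nbhsx_ballx x e e0) => y; rewrite -ball_normE.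
suff : \forall y \near x, (clink m `&` U) y ->
  `|col_mx x (E x) - col_mx y (E y)| < e by [].
apply: filterS2 Ee xe => y + xy => /[apply] Ey.
rewrite [X in `|X|](_ : _ = col_mx (x - y) (E x - E y)); first exact: norm_col_mx_lt.
by rewrite -add_col_mx -opp_col_mx.
Qed.

End Orientation.

(** * The torus *)

Definition l0 : 'I_(2 + 2) := lshift 2 (@Ordinal 2 0 isT).
Definition l1 : 'I_(2 + 2) := lshift 2 (@Ordinal 2 1 isT).
Definition r0 : 'I_(2 + 2) := rshift 2 (@Ordinal 2 0 isT).
Definition r1 : 'I_(2 + 2) := rshift 2 (@Ordinal 2 1 isT).

Lemma ord22P (P : 'I_(2 + 2) -> Prop) : P l0 -> P l1 -> P r0 -> P r1 -> forall k, P k.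
Proof.
move=> P0 P1 P2 P3 [[|[|[|[|//]]]] k4]; [move: P0|move: P1|move: P2|move: P3];
  congr P; exact/val_inj.
Qed.

Section Torus.
Context {R : realType}.
Implicit Types x : 'rV[R]_(2 + 2).

Lemma torus2E x : torus2 x <->
  x 0 l0 ^+ 2 + x 0 l1 ^+ 2 = 1 /\ x 0 r0 ^+ 2 + x 0 r1 ^+ 2 = 1.
Proof.
rewrite /torus2 /unit_sphere /= !dotE !big_ord_recl !big_ord0 !mxE !addr0.
rewrite -!expr2 /l0 /l1 /r0 /r1.
rewrite (_ : lift ord0 ord0 = @Ordinal 2 1 isT); last exact/val_inj.
by rewrite (_ : ord0 = @Ordinal 2 0 isT); last exact/val_inj.
Qed.

Definition row4 (a b c d : R) : 'rV[R]_(2 + 2) := \row_k [:: a; b; c; d]`_k.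

Lemma row4E a b c d : [/\ row4 a b c d 0 l0 = a, row4 a b c d 0 l1 = b,
  row4 a b c d 0 r0 = c & row4 a b c d 0 r1 = d].
Proof. by rewrite !mxE. Qed.

Lemma Ck_row4 (V : normedModType R) k (U : set V) (a b c d : V -> R) : open U ->
  Ck k U a -> Ck k U b -> Ck k U c -> Ck k U d ->
  Ck k U (fun v => row4 (a v) (b v) (c v) (d v)).
Proof.
move=> Uo ak bk ck dk; apply: Ck_rV => //; apply: ord22P.
- by apply: Ck_ext ak => // v _; rewrite mxE.
- by apply: Ck_ext bk => // v _; rewrite mxE.
- by apply: Ck_ext ck => // v _; rewrite mxE.
- by apply: Ck_ext dk => // v _; rewrite mxE.
Qed.

(* Stereographic coordinate on the circle, centred at the point (c, s). *)
Definition stereo (c s u : R) : R * R :=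
  let a := (1 - u ^+ 2) / (1 + u ^+ 2) in let b := 2 * u / (1 + u ^+ 2) in
  (c * a - s * b, s * a + c * b).

(** The tangent of half the angle from [(c, s)] to [(a, b)], in the form sine over one plus
    cosine. *)
Definition unstereo (c s a b : R) : R := (c * b - s * a) / (1 + (c * a + s * b)).

Lemma stereo_circle c s u : c ^+ 2 + s ^+ 2 = 1 ->
  (stereo c s u).1 ^+ 2 + (stereo c s u).2 ^+ 2 = 1 /\
  0 < 1 + (c * (stereo c s u).1 + s * (stereo c s u).2).
Proof.
move=> cs; have u1 : 0 < 1 + u ^+ 2 by rewrite ltr_pwDl ?sqr_ge0.
rewrite /stereo /=; set a := (1 - u ^+ 2) / (1 + u ^+ 2); set b := 2 * u / (1 + u ^+ 2).
have ab : a ^+ 2 + b ^+ 2 = 1 by rewrite /a /b; field; rewrite gt_eqF.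
have a1 : 1 + a = 2 / (1 + u ^+ 2) by rewrite /a; field; rewrite gt_eqF.
split.
  transitivity ((c ^+ 2 + s ^+ 2) * (a ^+ 2 + b ^+ 2)); first by ring.
  by rewrite cs ab mulr1.
rewrite (_ : _ + _ = 1 + (c ^+ 2 + s ^+ 2) * a); last by ring.
by rewrite cs mul1r a1 divr_gt0.
Qed.

Lemma stereoK c s u : c ^+ 2 + s ^+ 2 = 1 ->
  unstereo c s (stereo c s u).1 (stereo c s u).2 = u.
Proof.
move=> cs; have u1 : 0 < 1 + u ^+ 2 by rewrite ltr_pwDl ?sqr_ge0.
rewrite /unstereo /stereo /=; set a := (1 - u ^+ 2) / (1 + u ^+ 2); set b := 2 * u / (1 + u ^+ 2).
have a1 : 1 + a = 2 / (1 + u ^+ 2) by rewrite /a; field; rewrite gt_eqF.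
rewrite (_ : c * _ - _ = (c ^+ 2 + s ^+ 2) * b); last by ring.
rewrite (_ : c * _ + _ = (c ^+ 2 + s ^+ 2) * a); last by ring.
rewrite cs !mul1r a1 /b; field; by rewrite gt_eqF.
Qed.

Lemma unstereoK c s a b : c ^+ 2 + s ^+ 2 = 1 -> a ^+ 2 + b ^+ 2 = 1 ->
  0 < 1 + (c * a + s * b) ->
  stereo c s (unstereo c s a b) = (a, b).
Proof.
move=> cs ab; rewrite /unstereo /stereo /=.
set A := c * a + s * b; set B := c * b - s * a => A1.
have AB : A ^+ 2 + B ^+ 2 = 1.
  transitivity ((c ^+ 2 + s ^+ 2) * (a ^+ 2 + b ^+ 2)); first by rewrite /A /B; ring.
  by rewrite cs ab mulr1.
have B2 : B ^+ 2 = (1 - A) * (1 + A).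
  by rewrite -[LHS](addKr (A ^+ 2)) AB; ring.
have A0 : 1 + A != 0 by rewrite gt_eqF.
have e1 : 1 + (B / (1 + A)) ^+ 2 = 2 / (1 + A).
  by rewrite exprMn B2; field.
have e2 : 1 - (B / (1 + A)) ^+ 2 = 2 * A / (1 + A).
  by rewrite exprMn B2; field.
rewrite e1 e2.
have -> : 2 * A / (1 + A) / (2 / (1 + A)) = A by field; rewrite A0.
have -> : 2 * (B / (1 + A)) / (2 / (1 + A)) = B by field; rewrite A0.
congr pair; rewrite /A /B.
  transitivity ((c ^+ 2 + s ^+ 2) * a); first by ring.
  by rewrite cs mul1r.
transitivity ((c ^+ 2 + s ^+ 2) * b); first by ring.
by rewrite cs mul1r.
Qed.

Lemma Ck_stereo (V : normedModType R) k (U : set V) c s (u : V -> R) : open U ->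
  Ck k U u -> Ck k U (fun v => (stereo c s (u v)).1) /\
              Ck k U (fun v => (stereo c s (u v)).2).
Proof.
move=> Uo uk; have u1 v : 1 + u v ^+ 2 != 0 by rewrite gt_eqF// ltr_pwDl ?sqr_ge0.
have dk : Ck k U (fun v => (1 + u v ^+ 2)^-1).
  by apply: CkV => //; apply: CkD => //; [exact: Ck_cst|exact: CkX].
have ak : Ck k U (fun v => (1 - u v ^+ 2) / (1 + u v ^+ 2)).
  apply: CkM => //; apply: CkD => //; first exact: Ck_cst.
  by apply: CkN => //; exact: CkX.
have bk : Ck k U (fun v => 2 * u v / (1 + u v ^+ 2)).
  by apply: CkM => //; apply: CkM => //; exact: Ck_cst.
have ck r : Ck k U (fun=> r : R) by exact: Ck_cst.
split; rewrite /stereo /=.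
  by apply: CkD => //; [exact: CkM|apply: CkN => //; exact: CkM].
by apply: CkD => //; exact: CkM.
Qed.

Lemma Ck_unstereo (V : normedModType R) k (U : set V) c s (a b : V -> R) : open U ->
  Ck k U a -> Ck k U b -> (forall v, U v -> 0 < 1 + (c * a v + s * b v)) ->
  Ck k U (fun v => unstereo c s (a v) (b v)).
Proof.
move=> Uo ak bk ab; have ck r : Ck k U (fun=> r : R) by exact: Ck_cst.
apply: CkM => //.
  by apply: CkD => //; [exact: CkM|apply: CkN => //; exact: CkM].
apply: CkV => // [v Uv|]; first by rewrite gt_eqF// ab.
by apply: CkD => //; apply: CkD => //; exact: CkM.
Qed.

Lemma torus2_submanifold : submanifold 2 (@torus2 R).
Proof.
move=> p /torus2E[p1 p2].
pose e c s a b := 1 + (c * a + s * b) : R.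
pose h1 x := e (p 0 l0) (p 0 l1) (x 0 l0) (x 0 l1).
pose h2 x := e (p 0 r0) (p 0 r1) (x 0 r0) (x 0 r1).
have co i k (U : set 'rV[R]_(2 + 2)) : open U -> Ck k U (fun x => x 0 i).
  by move=> Uo; apply: Ck_coord => //; exact: Ck_id.
have hc i j a b : continuous (fun x : 'rV[R]_(2 + 2) => e a b (x 0 i) (x 0 j)).
  move=> x; have C : Ck 0 setT (fun x : 'rV[R]_(2 + 2) => e a b (x 0 i) (x 0 j)).
    have oT := @openT ('rV[R]_(2 + 2) : topologicalType).
    apply: CkD => //; first exact: Ck_cst.
    by apply: CkD => //; apply: CkM => //; try exact: Ck_cst; exact: co.
  exact: (C x Logic.I).
(* On the torus this excludes exactly the points antipodal to [p] in one of the two circles, so a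
   product of two stereographic charts covers the rest with the whole plane. *)
pose W : set 'rV[R]_(2 + 2) := [set x | 0 < h1 x] `&` [set x | 0 < h2 x].
have Wo : open W.
  apply: openI; first by have := @open_comp _ _ h1 _ (fun x _ => hc _ _ _ _ x) (@open_gt _ 0).
  by have := @open_comp _ _ h2 _ (fun x _ => hc _ _ _ _ x) (@open_gt _ 0).
pose f (u : 'rV[R]_2) : 'rV[R]_(2 + 2) :=
  row4 (stereo (p 0 l0) (p 0 l1) (u 0 0)).1 (stereo (p 0 l0) (p 0 l1) (u 0 0)).2
       (stereo (p 0 r0) (p 0 r1) (u 0 1)).1 (stereo (p 0 r0) (p 0 r1) (u 0 1)).2.
pose g x : 'rV[R]_2 := \row_(k < 2) [:: unstereo (p 0 l0) (p 0 l1) (x 0 l0) (x 0 l1);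
   unstereo (p 0 r0) (p 0 r1) (x 0 r0) (x 0 r1)]`_k.
exists W, setT; split.
- split=> //; split; rewrite /h1 /h2 /e /= -!expr2 ?p1 ?p2; lra.
- exact: openT.
exists f, g; split.
- apply: (Cinfty_smooth_on (U := setT)) => // [|k]; first exact: openT.
  have oT := @openT ('rV[R]_2 : topologicalType).
  have cu i : Ck k setT (fun u : 'rV[R]_2 => u 0 i) by apply: Ck_coord => //; exact: Ck_id.
  have [a1 b1] := Ck_stereo (p 0 l0) (p 0 l1) oT (cu 0).
  have [a2 b2] := Ck_stereo (p 0 r0) (p 0 r1) oT (cu 1).
  exact: Ck_row4.
- apply: (Cinfty_smooth_on (U := W)) => // k.
  apply: Ck_rV => // -[[|[|//]] k2].
    apply: (Ck_ext (f := fun x => unstereo (p 0 l0) (p 0 l1) (x 0 l0) (x 0 l1))) => //.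
      by move=> x _; rewrite mxE.
    by apply: Ck_unstereo => // [||x []//]; exact: co.
  apply: (Ck_ext (f := fun x => unstereo (p 0 r0) (p 0 r1) (x 0 r0) (x 0 r1))) => //.
    by move=> x _; rewrite mxE.
  by apply: Ck_unstereo => // [||x []//]; exact: co.
- move=> u _; have [fu1 fu2 fu3 fu4] := row4E
   (stereo (p 0 l0) (p 0 l1) (u 0 0)).1 (stereo (p 0 l0) (p 0 l1) (u 0 0)).2
   (stereo (p 0 r0) (p 0 r1) (u 0 1)).1 (stereo (p 0 r0) (p 0 r1) (u 0 1)).2.
  have [s1 s2] := stereo_circle (u 0 0) p1; have [s3 s4] := stereo_circle (u 0 1) p2.
  split.
    split; first by apply/torus2E; rewrite /f fu1 fu2 fu3 fu4.
    by split; rewrite /= /h1 /h2 /e /f ?fu1 ?fu2 ?fu3 ?fu4.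
  apply/rowP => -[[|[|//]] k2]; rewrite mxE /= /f.
    by rewrite fu1 fu2 stereoK//; congr (u 0 _); exact/val_inj.
  by rewrite fu3 fu4 stereoK//; congr (u 0 _); exact/val_inj.
- move=> x [/torus2E[x1 x2] [W1 W2]]; split=> //.
  have g0 : g x 0 0 = unstereo (p 0 l0) (p 0 l1) (x 0 l0) (x 0 l1) by rewrite mxE.
  have g1 : g x 0 1 = unstereo (p 0 r0) (p 0 r1) (x 0 r0) (x 0 r1) by rewrite mxE.
  rewrite /f g0 g1 !unstereoK//.
  by apply/rowP; apply: ord22P; rewrite mxE.
Qed.

End Torus.

Section TorusParam.
Context {R : realType} (m : nat).
Hypothesis m_gt0 : (0 < m)%N.

(** Eliminating the third coordinate between the quadric and the unit sphere leaves the ellipse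
    (3m+1) y_1^2 + (3m+2) y_2^2 = 2m+1. These are its semi-axes, and [height2] is the resulting
    y_3^2 in terms of a point of the unit circle. *)
Definition axis0 : R := Num.sqrt (m.*2.+1%:R / (3 * m%:R + 1)).
Definition axis1 : R := Num.sqrt (m.*2.+1%:R / (3 * m%:R + 2)).
Definition height2 (c s : R) : R :=
  m%:R / (3 * m%:R + 1) * c ^+ 2 + (m%:R + 1) / (3 * m%:R + 2) * s ^+ 2.
Definition ellipse (c s : R) : 'rV[R]_3 :=
  \row_k [:: axis0 * c; axis1 * s; Num.sqrt (height2 c s)]`_k.

Let M : R := m%:R.
Let M_ge1 : 1 <= M. Proof. by rewrite ler1n. Qed.
Let d2E : m.*2.+1%:R = 2 * M + 1 :> R.
Proof. by rewrite -natr1 -mul2n natrM. Qed.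

Lemma axis0_sqr : axis0 ^+ 2 = (2 * m%:R + 1) / (3 * m%:R + 1).
Proof. by rewrite sqr_sqrtr d2E// divr_ge0; move: M_ge1; rewrite /M; lra. Qed.

Lemma axis1_sqr : axis1 ^+ 2 = (2 * m%:R + 1) / (3 * m%:R + 2).
Proof. by rewrite sqr_sqrtr d2E// divr_ge0; move: M_ge1; rewrite /M; lra. Qed.

Lemma axis0_gt0 : 0 < axis0.
Proof. by rewrite sqrtr_gt0 d2E divr_gt0; move: M_ge1; rewrite /M; lra. Qed.

Lemma axis1_gt0 : 0 < axis1.
Proof. by rewrite sqrtr_gt0 d2E divr_gt0; move: M_ge1; rewrite /M; lra. Qed.

(** Both coefficients are at least 1/4, the first with equality at [m = 1]. That the bound is
    uniform in [m] matters for the speed estimate. *)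
Lemma height2_ge c s : c ^+ 2 + s ^+ 2 = 1 -> 1 / 4 <= height2 c s.
Proof.
move=> cs; rewrite /height2 -/M; have M1 := M_ge1.
have e1 : 1 / 4 <= M / (3 * M + 1) by rewrite ler_pdivlMr; lra.
have e2 : 1 / 4 <= (M + 1) / (3 * M + 2) by rewrite ler_pdivlMr; lra.
rewrite (_ : 1 / 4 = 1 / 4 * c ^+ 2 + 1 / 4 * s ^+ 2); last by rewrite -mulrDr cs mulr1.
by rewrite lerD// ler_wpM2r// sqr_ge0.
Qed.

Lemma ellipseE c s : [/\ ellipse c s 0 o0 = axis0 * c, ellipse c s 0 o1 = axis1 * s &
  ellipse c s 0 o2 = Num.sqrt (height2 c s)].
Proof. by rewrite !mxE. Qed.

Lemma ellipseP c s : c ^+ 2 + s ^+ 2 = 1 ->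
  [/\ quadric m (ellipse c s), 0 < ellipse c s 0 o2 & \sum_k ellipse c s 0 k ^+ 2 = 1].
Proof.
move=> cs; have h := height2_ge cs; have M1 := M_ge1.
have [e0 e1 e2] := ellipseE c s.
have s2 : Num.sqrt (height2 c s) ^+ 2 = height2 c s by rewrite sqr_sqrtr//; lra.
rewrite /quadric !sum3E e0 e1 e2 !exprMn s2 axis0_sqr axis1_sqr /weight /= d2E.
rewrite sqrtr_gt0 -natr1 -/M; split; last 1 first.
- by transitivity (c ^+ 2 + s ^+ 2) => //; rewrite /height2 -/M; field;
    rewrite !gt_eqF//; lra.
- by rewrite /height2 -/M; field; rewrite !gt_eqF//; lra.
- lra.
Qed.

Lemma ellipse_onto (y : 'rV[R]_3) : quadric m y -> 0 < y 0 o2 ->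
  \sum_k y 0 k ^+ 2 = 1 ->
  let c := y 0 o0 / axis0 in let s := y 0 o1 / axis1 in
  c ^+ 2 + s ^+ 2 = 1 /\ ellipse c s = y.
Proof.
move=> q y2 y1 c s; have M1 := M_ge1.
rewrite /quadric !sum3E /weight /= d2E -natr1 -/M in q y1.
have a0 := axis0_gt0; have a1 := axis1_gt0.
have c2 : c ^+ 2 = (3 * M + 1) / (2 * M + 1) * y 0 o0 ^+ 2.
  by rewrite exprMn exprVn axis0_sqr -/M; field; rewrite !gt_eqF//; lra.
have s2 : s ^+ 2 = (3 * M + 2) / (2 * M + 1) * y 0 o1 ^+ 2.
  by rewrite exprMn exprVn axis1_sqr -/M; field; rewrite !gt_eqF//; lra.
have y22 : y 0 o2 ^+ 2 = (M * y 0 o0 ^+ 2 + (M + 1) * y 0 o1 ^+ 2) / (2 * M + 1).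
  have d : 2 * M + 1 != 0 by rewrite gt_eqF//; lra.
  apply: (mulIf d); rewrite divfK//; apply/eqP; rewrite -subr_eq0; apply/eqP.
  by rewrite -[RHS]oppr0 -q; ring.
split.
  rewrite -[RHS]y1 c2 s2 y22; field; rewrite gt_eqF//; lra.
have h : height2 c s = y 0 o2 ^+ 2.
  by rewrite /height2 c2 s2 y22 -/M; field; rewrite !gt_eqF//; lra.
apply/rowP; apply: ord3P; rewrite mxE /=.
- by rewrite mulrC divfK// gt_eqF.
- by rewrite mulrC divfK// gt_eqF.
- by rewrite h sqrtr_sqr gtr0_norm.
Qed.

Lemma Ck_ellipse (V : normedModType R) j (U : set V) (c s : V -> R) k : open U ->
  Ck j U c -> Ck j U s -> (forall v, U v -> 0 < height2 (c v) (s v)) ->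
  Ck j U (fun v => ellipse (c v) (s v) 0 k).
Proof.
move=> Uo cj sj h0; have cst r : Ck j U (fun=> r : R) by exact: Ck_cst.
move: k; apply: ord3P.
- apply: (Ck_ext (f := fun v => axis0 * c v)) => //; last exact: CkM.
  by move=> v _; rewrite mxE.
- apply: (Ck_ext (f := fun v => axis1 * s v)) => //; last exact: CkM.
  by move=> v _; rewrite mxE.
- apply: (Ck_ext (f := fun v => Num.sqrt (height2 (c v) (s v)))) => //.
    by move=> v _; rewrite mxE.
  apply: Ck_sqrt => //; apply: CkD => //; apply: CkM => //; exact: CkX.
Qed.

Definition of_torus (x : 'rV[R]_(2 + 2)) : 'rV[R]_(3 + 3) :=
  param m (ellipse (x 0 l0) (x 0 l1)) (x 0 r0 +i* x 0 r1).

Definition to_torus (x : 'rV[R]_(3 + 3)) : 'rV[R]_(2 + 2) :=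
  row4 (radial m x 0 o0 / axis0) (radial m x 0 o1 / axis1)
       (complex.Re (angle x)) (complex.Im (angle x)).

Lemma clink_param (y : 'rV[R]_3) (E : R[i]) : E * conjc E = 1 -> quadric m y -> 0 < y 0 o2 ->
  \sum_k y 0 k ^+ 2 = 1 -> clink m (param m y E).
Proof.
move=> E1 q y2 y1; split; first by exists y, E.
by rewrite /unit_sphere /= dot_param.
Qed.

Lemma clinkE (x : 'rV[R]_(3 + 3)) : clink m x -> \sum_k radial m x 0 k ^+ 2 = 1.
Proof.
move=> [Xx x1]; have [E1 _ _ xE] := cone0E Xx.
by rewrite -(dot_param m _ E1) xE.
Qed.

(** One circle runs along the ellipse, the other is the phase. The inverse reads off [radial] and
    [angle], smooth on the open set [dom]; the forward map is smooth where [height2] is positive. *)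
Lemma torus_diffeo : diffeo torus2 (@clink R m) of_torus to_torus.
Proof.
pose U : set 'rV[R]_(2 + 2) := [set x | 0 < height2 (x 0 l0) (x 0 l1)].
have co i k (A : set 'rV[R]_(2 + 2)) : open A -> Ck k A (fun x => x 0 i).
  by move=> Ao; apply: Ck_coord => //; exact: Ck_id.
have hk k : Ck k setT (fun x : 'rV[R]_(2 + 2) => height2 (x 0 l0) (x 0 l1)).
  have oT := @openT ('rV[R]_(2 + 2) : topologicalType).
  by apply: CkD => //; apply: CkM => //; try exact: Ck_cst; apply: CkX => //; exact: co.
have Uo : open U.
  have hc x : {for x, continuous (fun x : 'rV[R]_(2 + 2) => height2 (x 0 l0) (x 0 l1))}.
    exact: (hk 0%N x Logic.I).
  by have := @open_comp _ _ _ _ (fun x _ => hc x) (@open_gt _ 0).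
split.
- apply: (Cinfty_smooth_on Uo) => [x /torus2E[x1 _]|j].
    by have := height2_ge x1; rewrite /U /=; lra.
  apply: Ck_param => // [k|]; last by split=> /=; exact: co.
  by apply: Ck_ellipse => //; exact: co.
- apply: (Cinfty_smooth_on (@dom_open R)) => [x [/cone0_dom]//|j].
  have Do := @dom_open R; have [ra ja] := @CkC_angle R j.
  by apply: Ck_row4 => //; apply: CkM => //; try exact: Ck_cst; exact: Ck_radial.
- move=> x /torus2E[x1 x2]; have [q y2 y1] := ellipseP x1.
  have E1 : (x 0 r0 +i* x 0 r1) * conjc (x 0 r0 +i* x 0 r1) = 1.
    exact/mulcJ_eq1.
  split; first exact: clink_param.
  rewrite /to_torus /of_torus radial_param// angle_param//.
  have [-> -> _] := ellipseE (x 0 l0) (x 0 l1).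
  apply/rowP; apply: ord22P; rewrite mxE //=.
    by rewrite mulrC mulKf// gt_eqF// axis0_gt0.
  by rewrite mulrC mulKf// gt_eqF// axis1_gt0.
- move=> x Lx; have y1 := clinkE Lx; have [E1 q y2 xE] := cone0E Lx.1.
  have [cs eE] := ellipse_onto q y2 y1.
  have /mulcJ_eq1 E1' := E1.
  have [t0 t1 t2 t3] := row4E (radial m x 0 o0 / axis0) (radial m x 0 o1 / axis1)
       (complex.Re (angle x)) (complex.Im (angle x)).
  split; first by apply/torus2E; rewrite /to_torus t0 t1 t2 t3.
  rewrite /of_torus /to_torus t0 t1 t2 t3 eE -[RHS]xE; congr param.
  by case: (angle x).
Qed.

Lemma clink_submanifold : submanifold 2 (@clink R m).
Proof. exact: submanifold_diffeo torus_diffeo torus2_submanifold. Qed.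

Lemma clink_torus : embedded_torus (@clink R m).
Proof.
split; first exact: clink_submanifold.
by exists of_torus, to_torus; exact: torus_diffeo.
Qed.

Lemma torus2_compact : compact (@torus2 R).
Proof.
apply: bounded_closed_compact.
  exists 1; split; first exact: num_real.
  move=> r r1 x /torus2E[x1 x2]; rewrite /= [leLHS]mx_normrE.
  apply/bigmax_leP; split=> [|[i j] _ /=]; first lra.
  rewrite ord1; have : x 0 j ^+ 2 <= 1.
    move: j; apply: ord22P.
    - by rewrite -x1 lerDl sqr_ge0.
    - by rewrite -x1 lerDr sqr_ge0.
    - by rewrite -x2 lerDl sqr_ge0.
    - by rewrite -x2 lerDr sqr_ge0.
  move=> xj; apply: le_trans (ltW r1).
  by rewrite -(@expr_le1 _ 2)// real_normK ?num_real.
have Q i j : continuous (fun x : 'rV[R]_(2 + 2) => x 0 i ^+ 2 + x 0 j ^+ 2).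
  move=> x; have oT := @openT ('rV[R]_(2 + 2) : topologicalType).
  have C : Ck 0 setT (fun x : 'rV[R]_(2 + 2) => x 0 i ^+ 2 + x 0 j ^+ 2).
    by apply: CkD => //; apply: CkX => //; apply: Ck_coord => //; exact: Ck_id.
  exact: (C x Logic.I).
rewrite (_ : torus2 = ((fun x => x 0 l0 ^+ 2 + x 0 l1 ^+ 2) @^-1` [set 1]) `&`
   ((fun x => x 0 r0 ^+ 2 + x 0 r1 ^+ 2) @^-1` [set 1])).
  by apply: closedI; apply: closed_comp => //; try (by move=> x _; exact: Q); exact: closed_eq.
by apply/seteqP; split=> x /torus2E.
Qed.

Lemma clink_compact : compact (@clink R m).
Proof.
have [fs _ fX gY] := torus_diffeo.
rewrite (_ : clink m = of_torus @` torus2).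
  apply: continuous_compact; last exact: torus2_compact.
  apply/subspace_continuousP => x Tx N NN.
  exact: (smooth_on_continuous fs Tx NN).
apply/seteqP; split=> [x /gY[Tx <-]|_ [x Tx <-]]; last exact: (fX x Tx).1.
by exists (to_torus x).
Qed.

End TorusParam.

(** * Intrinsic size of the links *)

Section Speed.
Context {R : realType} (m : nat).
Hypothesis m_gt0 : (0 < m)%N.
Implicit Types (c : R -> 'rV[R]_(3 + 3)).

Lemma circle_polar (a b : R) : a ^+ 2 + b ^+ 2 = 1 ->
  exists t, [/\ - pi <= t <= pi, a = cos t & b = sin t].
Proof.
move=> ab; have a1 : -1 <= a <= 1.
  rewrite -ler_norml -(@expr_le1 _ 2)// real_normK ?num_real//.
  by rewrite -ab lerDl sqr_ge0.
have ca : cos (acos a) = a by rewrite acosK// in_itv.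
have sa : sin (acos a) = `|b|.
  by rewrite sin_acos// -ab addrAC subrr add0r sqrtr_sqr.
have p0 := @pi_ge0 R; have t0 := acos_ge0 a1; have t1 := acos_lepi a1.
have [b0|b0] := leP 0 b.
  by exists (acos a); rewrite ca sa ger0_norm//; split=> //; apply/andP; split; lra.
exists (- acos a); rewrite cosN sinN ca sa ltr0_norm// opprK.
by split=> //; apply/andP; split; lra.
Qed.

Lemma dot_velocity (w n : 'rV[R]_3) (om : R) (E : R[i]) : E * conjc E = 1 ->
  let v := of_complex (\row_k
    (((w 0 k)%:C + 'i%C * (om * n 0 k)%:C) * phase m E k)) in
  dot v v = \sum_k w 0 k ^+ 2 + om ^+ 2 * \sum_k n 0 k ^+ 2.
Proof.
move=> E1 v; rewrite dot_of_complex mulr_sumr -big_split; apply: eq_bigr => k _ /=.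
by rewrite mxE conjcM mulrACA phase_unit// mulr1 !cReImE /=; ring.
Qed.

Let weight_row x : 'rV[R]_3 := \row_k (weight m k * radial m x 0 k).

(** A weighted mean of the squared weights lies between bounds valid for each of them. It is the
    squared velocity of the circle action at a point of the link. *)
Lemma weight_ge (y : 'rV[R]_3) : \sum_k y 0 k ^+ 2 = 1 ->
  m%:R ^+ 2 <= \sum_k (weight m k * y 0 k) ^+ 2 <= (m.*2.+1%:R : R) ^+ 2.
Proof.
move=> y1; have W k : m%:R ^+ 2 <= (weight m k : R) ^+ 2 <= (m.*2.+1%:R : R) ^+ 2.
  by move: k; apply: ord3P; rewrite /weight /= ?sqrrN !ler_pXn2r ?nnegrE// !ler_nat
    -addnn; apply/andP; split; rewrite ?leqnn ?leqnSn// -?addnS ?leq_addr//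
    -?addSn ?leq_addl// -addSnnS leq_addl.
have e (z : R) : z = \sum_k z * y 0 k ^+ 2 by rewrite -mulr_sumr y1 mulr1.
apply/andP; split; [rewrite [leLHS]e|rewrite [leRHS]e]; apply: ler_sum => k _;
  by rewrite exprMn ler_wpM2r ?sqr_ge0//; case/andP: (W k).
Qed.

(** Two points with the same radius and phases [E = 1] and [E = -1] are joined. The real part of the
    angle drops by 2 in unit time, so at some instant its derivative is -2. That derivative is at
    most [om] in absolute value, while the speed is at least [m] times the absolute value of
    [om]. *)
Lemma joined_lower_bound L : joined_at_speed L (cone0 m : set 'rV[R]_(3 + 3)) ->
  4 * m%:R ^+ 2 <= L ^+ 2.
Proof.
have [q y2 y1] := @ellipseP R m m_gt0 1 0 ltac:(by rewrite expr1n expr0n addr0).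
set y := ellipse m 1 0 in q y2 y1.
have P1 : (1 : R[i]) * conjc 1 = 1 by rewrite conjc1 mulr1.
have PN1 : (-1 : R[i]) * conjc (-1) = 1.
  by apply/mulcJ_eq1; rewrite cReN cImN /=; ring.
have [p [p' [X1 XN1 [n1 nN1 a1 aN1]]]] : exists p p' : 'rV[R]_(3 + 3), [/\ cone0 m p, cone0 m p' &
    [/\ dot p p = 1, dot p' p' = 1, angle p = 1 & angle p' = -1]].
  exists (param m y 1), (param m y (-1)); split; [by exists y, 1|by exists y, (-1)|].
  split; [by rewrite (dot_param m y P1)|by rewrite (dot_param m y PN1)|
    by rewrite (angle_param P1 q y2)|by rewrite (angle_param PN1 q y2)].
move=> /(_ p p' X1 XN1 n1 nN1).
move=> [I [c [[Io I01 cs c0 c1] cI]]].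
have cX t : I t -> cone0 m (c t) by move=> /cI[].
pose h t := complex.Re (angle (c t)).
have H t : I t -> exists2 d, is_derive t 1 h d & m%:R ^+ 2 * d ^+ 2 <= L ^+ 2.
  move=> It; have [w [om [_ _ [ra _] c']]] := cone0_velocity Io cs cX It.
  have [Xct ct1 Lc'] := cI t It; have [E1 _ _ ctE] := cone0E Xct.
  eexists; first exact: ra.
  have r1 : \sum_k radial m (c t) 0 k ^+ 2 = 1 by exact: clinkE.
  apply: le_trans Lc'; rewrite c'.
  have -> : \row_k (((w 0 k)%:C + 'i%C * (om * (weight m k * radial m (c t) 0 k))%:C) *
      phase m (angle (c t)) k) = \row_k (((w 0 k)%:C +
      'i%C * (om * weight_row (c t) 0 k)%:C) * phase m (angle (c t)) k).
    by apply/rowP => k; rewrite [LHS]mxE [RHS]mxE [weight_row _ _ _]mxE.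
  rewrite dot_velocity//.
  have /andP[W _] := weight_ge r1.
  have -> : \sum_k weight_row (c t) 0 k ^+ 2 = \sum_k (weight m k * radial m (c t) 0 k) ^+ 2.
    by apply: eq_bigr => k _; rewrite mxE.
  have /mulcJ_eq1 e1 := E1.
  apply: (@le_trans _ _ (om ^+ 2 * m%:R ^+ 2)).
    have -> : complex.Re ('i%C * om%:C * angle (c t)) = - (om * complex.Im (angle (c t))).
      by rewrite !cReM !cImM /=; ring.
    rewrite mulrC ler_wpM2r ?sqr_ge0// sqrrN exprMn ler_piMr ?sqr_ge0//.
    by rewrite -e1 lerDr sqr_ge0.
  rewrite ler_wpDl ?sumr_ge0//; first by move=> k _; exact: sqr_ge0.
  by rewrite ler_wpM2l ?sqr_ge0.
have Du t : t \in `[(0 : R), 1] -> is_derive t 1 h ('D_1 h t).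
  by move=> t01; have [d dh _] := H t (I01 t t01); exact: derivableP.
have [x x01] := MVT_segment ler01 (fun x xab => Du x (subset_itv_oo_cc xab))
  (derivable_within_continuous (fun t tab => @ex_derive _ _ _ _ _ _ _ (Du t tab))).
rewrite /h c0 c1 a1 aN1 subr0 mulr1 /=.
have [d dh Ld] := H x (I01 x x01); rewrite (@derive_val _ _ _ _ _ _ _ dh) => E.
apply: le_trans Ld; rewrite -E mulrC ler_wpM2l ?sqr_ge0//; lra.
Qed.

Definition polar (a b : R) : 'rV[R]_(3 + 3) :=
  param m (ellipse m (cos a) (sin a)) (cos b +i* sin b).

Lemma clink_polar (p : 'rV[R]_(3 + 3)) : clink m p -> exists a b,
  [/\ - pi <= a <= pi, - pi <= b <= pi & p = polar a b].
Proof.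
move=> Lp; have [_ _ _ gY] := torus_diffeo (R := R) m_gt0.
have [/torus2E[t1 t2] <-] := gY p Lp; rewrite /of_torus.
have [a [api -> ->]] := circle_polar t1; have [b [bpi -> ->]] := circle_polar t2.
by exists a, b.
Qed.

Lemma is_derive_affine (a d t : R) : is_derive t 1 (fun s => a + d * s) d.
Proof.
have e : is_derive t (1 : R) (cst a + d *: id) (0 + d *: 1).
  by apply: is_deriveD.
by apply: is_derive_eq e _; rewrite add0r /GRing.scale /= mulr1.
Qed.

(** The orthogonality relation is solved for [w2]: [y2 ^+ 2 >= 1 / 4] costs a factor 4, squaring the
    two-term sum a factor 2, and [y0 ^+ 2 + y1 ^+ 2 <= 1] leaves 4 * 2 * 64 = 512. *)
Lemma speed_bound (M y0 y1 y2 w0 w1 w2 : R) : 1 <= M ->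
  y0 ^+ 2 + y1 ^+ 2 + y2 ^+ 2 = 1 -> 1 / 4 <= y2 ^+ 2 ->
  w0 ^+ 2 <= 64 -> w1 ^+ 2 <= 64 ->
  M * y0 * w0 + (M + 1) * y1 * w1 - (2 * M + 1) * y2 * w2 = 0 ->
  w2 ^+ 2 <= 512.
Proof.
move=> M1 ys y2b w0b w1b o.
have h0 : y0 ^+ 2 * w0 ^+ 2 <= y0 ^+ 2 * 64 by rewrite ler_wpM2l ?sqr_ge0.
have h1 : y1 ^+ 2 * w1 ^+ 2 <= y1 ^+ 2 * 64 by rewrite ler_wpM2l ?sqr_ge0.
have N0 : 0 < (M + 1) ^+ 2 by rewrite exprn_gt0//; lra.
rewrite -(ler_pM2l N0).
have h2 : (M + 1) ^+ 2 * w2 ^+ 2 <= 4 * ((2 * M + 1) * y2 * w2) ^+ 2.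
  apply: (@le_trans _ _ ((2 * M + 1) ^+ 2 * w2 ^+ 2)).
    by rewrite ler_wpM2r ?sqr_ge0// ler_pXn2r ?nnegrE//; lra.
  rewrite (_ : 4 * _ = (4 * y2 ^+ 2) * ((2 * M + 1) ^+ 2 * w2 ^+ 2)); last by ring.
  rewrite ler_peMl//; first by apply: mulr_ge0; exact: sqr_ge0.
  move: y2b; set z := y2 ^+ 2; lra.
apply: le_trans h2 _.
have -> : (2 * M + 1) * y2 * w2 = M * y0 * w0 + (M + 1) * y1 * w1 by lra.
have h3 : (M * y0 * w0 + (M + 1) * y1 * w1) ^+ 2 <=
    2 * (M ^+ 2 * (y0 ^+ 2 * w0 ^+ 2)) + 2 * ((M + 1) ^+ 2 * (y1 ^+ 2 * w1 ^+ 2)).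
  rewrite -subr_ge0 (_ : _ - _ = (M * y0 * w0 - (M + 1) * y1 * w1) ^+ 2); last by ring.
  exact: sqr_ge0.
have h4 : M ^+ 2 * (y0 ^+ 2 * w0 ^+ 2) <= (M + 1) ^+ 2 * (y0 ^+ 2 * 64).
  apply: ler_pM => //; [exact: sqr_ge0|by apply: mulr_ge0; exact: sqr_ge0|].
  by rewrite ler_pXn2r ?nnegrE//; lra.
have h5 : (M + 1) ^+ 2 * (y1 ^+ 2 * w1 ^+ 2) <= (M + 1) ^+ 2 * (y1 ^+ 2 * 64).
  by rewrite ler_pM2l.
have h6 : (M + 1) ^+ 2 * (y0 ^+ 2 * 64) + (M + 1) ^+ 2 * (y1 ^+ 2 * 64) <= (M + 1) ^+ 2 * 64.
  by rewrite -mulrDr ler_pM2l//; have := sqr_ge0 y2; lra.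
lra.
Qed.

(** The joining curve is affine in the two torus angles. The ellipse coordinates then move at a rate
    bounded uniformly in [m]; only the rotation of the phase costs a multiple of [m]. *)
Lemma joined_upper_bound : joined_at_speed (64 * m%:R) (cone0 m : set 'rV[R]_(3 + 3)).
Proof.
move=> p q Xp Xq p1 q1.
have [a [b [api bpi pE]]] := clink_polar (conj Xp p1).
have [a' [b' [api' bpi' qE]]] := clink_polar (conj Xq q1).
pose d := a' - a; pose e := b' - b.
pose c t := polar (a + d * t) (b + e * t); exists setT, c.
have unitE t : (cos t +i* sin t) * conjc (cos t +i* sin t) = 1 :> R[i].
  by apply/mulcJ_eq1; exact: cos2Dsin2.
have cL t : clink m (c t).
  by have [eq e2 e1] := ellipseP m_gt0 (cos2Dsin2 (a + d * t)); exact: clink_param.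
have cs : Cinfty setT c.
  move=> k; have oT := @openT (R : topologicalType).
  have aff u v : Ck k setT (fun t : R => u + v * t).
    by apply: CkD => //; [exact: Ck_cst|apply: CkM => //; [exact: Ck_cst|exact: Ck_id]].
  have [ca sa] := Ck_cos_sin oT (aff a d); have [cb sb] := Ck_cos_sin oT (aff b e).
  apply: Ck_param => // j; apply: Ck_ellipse => // t _.
  by apply: lt_le_trans (height2_ge m_gt0 (cos2Dsin2 _)); lra.
split.
  split; [exact: openT|by []|exact: cs| |].
  - by rewrite /c mulr0 addr0 mulr0 addr0.
  - by rewrite /c mulr1 subrKC mulr1 subrKC.
move=> t _; have [Xct ct1] := cL t; split; [exact: Xct|exact: ct1|].
have [w [om [wn wd [ra ja] ->]]] := cone0_velocity openT cs (fun s _ => (cL s).1) (Logic.I : setT t).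
have [E1 _ _ _] := cone0E Xct.
have r1 := clinkE (cL t).
have -> : \row_k (((w 0 k)%:C + 'i%C * (om * (weight m k * radial m (c t) 0 k))%:C) *
    phase m (angle (c t)) k) = \row_k (((w 0 k)%:C +
    'i%C * (om * weight_row (c t) 0 k)%:C) * phase m (angle (c t)) k).
  by apply/rowP => k; rewrite [LHS]mxE [RHS]mxE [weight_row _ _ _]mxE.
rewrite dot_velocity//.
have /andP[_ W] := weight_ge r1.
have -> : \sum_k weight_row (c t) 0 k ^+ 2 = \sum_k (weight m k * radial m (c t) 0 k) ^+ 2.
  by apply: eq_bigr => k _; rewrite mxE.
have rE s : radial m (c s) = ellipse m (cos (a + d * s)) (sin (a + d * s)).
  by have [eq e2 e1] := ellipseP m_gt0 (cos2Dsin2 (a + d * s)); exact: radial_param.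
have aE s : angle (c s) = cos (b + e * s) +i* sin (b + e * s).
  by have [eq e2 e1] := ellipseP m_gt0 (cos2Dsin2 (a + d * s)); exact: angle_param eq e2.
have [rt0 rt1 rt2] := ellipseE (R := R) m (cos (a + d * t)) (sin (a + d * t)).
have dcos u v : is_derive t 1 (fun s => cos (u + v * s)) (- sin (u + v * t) * v).
  exact: (is_derive1_comp (is_derive_cos _) (is_derive_affine u v t)).
have dsin u v : is_derive t 1 (fun s => sin (u + v * s)) (cos (u + v * t) * v).
  exact: (is_derive1_comp (is_derive_sin _) (is_derive_affine u v t)).
have w0E : w 0 o0 = axis0 m * (- sin (a + d * t) * d).
  have e0 : is_derive t 1 (axis0 m *: (fun s : R => cos (a + d * s)))
    (axis0 m *: (- sin (a + d * t) * d)) by exact: is_deriveZ.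
  have [_ <-] := wd o0; have [_ ev] := e0; apply: etrans ev; congr ('D_1 _ t).
  by apply/funext => s; rewrite rE mxE.
have w1E : w 0 o1 = axis1 m * (cos (a + d * t) * d).
  have e1 : is_derive t 1 (axis1 m *: (fun s : R => sin (a + d * s)))
    (axis1 m *: (cos (a + d * t) * d)) by exact: is_deriveZ.
  have [_ <-] := wd o1; have [_ ev] := e1; apply: etrans ev; congr ('D_1 _ t).
  by apply/funext => s; rewrite rE mxE.
(* Comparing derivatives of real and imaginary parts gives the equality multiplied by the cosine and
   by the sine; combining the two avoids dividing by either. *)
have omE : om = e.
  have [_] := ra; have [_] := ja; have [_] := dcos b e; have [_] := dsin b e.
  have -> : (fun s => complex.Re (angle (c s))) = (fun s : R => cos (b + e * s)).
    by apply/funext => s; rewrite aE.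
  have -> : (fun s => complex.Im (angle (c s))) = (fun s : R => sin (b + e * s)).
    by apply/funext => s; rewrite aE.
  move=> -> -> + +; rewrite aE !cReImE /= => hs hc.
  have a1 : om * cos (b + e * t) = e * cos (b + e * t) by lra.
  have a2 : om * sin (b + e * t) = e * sin (b + e * t) by lra.
  rewrite -[LHS]mulr1 -[RHS]mulr1 -(cos2Dsin2 (b + e * t)) !mulrDr.
  by rewrite !expr2 !mulrA a1 a2.
(* Differences of angles in [[-pi, pi]] are at most [2 * pi < 8] in absolute value, whence the bound
   64 on their squares. *)
have pi4 : pi < 4 :> R by have := @pihalf_lt2 R; lra.
have sq8 x : - (2 * pi) <= x <= 2 * pi -> x ^+ 2 <= 64 :> R.
  move=> /andP[x1 x2]; rewrite (_ : 64 = 8 ^+ 2); last by ring.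
  rewrite -[x ^+ 2]real_normK ?num_real// ler_pXn2r ?nnegrE//.
  by rewrite ler_norml; apply/andP; split; lra.
have d8 : d ^+ 2 <= 64.
  by apply: sq8; move: api api'; rewrite /d => /andP[? ?] /andP[? ?]; apply/andP; split; lra.
have e8 : e ^+ 2 <= 64.
  by apply: sq8; move: bpi bpi'; rewrite /e => /andP[? ?] /andP[? ?]; apply/andP; split; lra.
have M1 : 1 <= m%:R :> R by rewrite ler1n.
have [sc1 ss1] : cos (a + d * t) ^+ 2 <= 1 /\ sin (a + d * t) ^+ 2 <= 1.
  by rewrite -(cos2Dsin2 (a + d * t)) lerDl lerDr !sqr_ge0.
have A0 : axis0 m ^+ 2 <= 1 :> R by rewrite axis0_sqr// ler_pdivrMr; lra.
have A1 : axis1 m ^+ 2 <= 1 :> R by rewrite axis1_sqr// ler_pdivrMr; lra.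
have sq64 x y z : x ^+ 2 <= 1 -> y ^+ 2 <= 1 -> z ^+ 2 <= 64 -> (x * (y * z)) ^+ 2 <= 64 :> R.
  move=> x1 y1 z1; rewrite !exprMn; apply: le_trans z1.
  rewrite mulrA ler_piMl ?sqr_ge0// mulr_ile1 ?sqr_ge0//.
have w0b : w 0 o0 ^+ 2 <= 64 by rewrite w0E sq64 ?sqrrN.
have w1b : w 0 o1 ^+ 2 <= 64 by rewrite w1E sq64.
have m2 : m.*2.+1%:R = 2 * m%:R + 1 :> R by rewrite -natr1 -mul2n natrM.
have w2b : w 0 o2 ^+ 2 <= 512.
  move: r1 wn; rewrite !sum3E => r1 wn.
  apply: (speed_bound M1 r1 _ w0b w1b).
    rewrite rE rt2 sqr_sqrtr; first exact: height2_ge (cos2Dsin2 _).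
    by apply: le_trans (height2_ge m_gt0 (cos2Dsin2 _)); lra.
  by rewrite -[RHS]wn /weight /= m2 -natr1; ring.
(* Here 640 = 64 + 64 + 512 bounds the radial part, and the second term the angular part; as
   [m >= 1], the sum is below [(64 * m) ^+ 2]. *)
apply: (@le_trans _ _ (640 + 64 * (m.*2.+1%:R) ^+ 2)).
  apply: lerD; first by rewrite sum3E; lra.
  rewrite omE; apply: ler_pM => //; first exact: sqr_ge0.
  by apply: sumr_ge0 => k _; exact: sqr_ge0.
by rewrite m2 exprMn; nra.
Qed.

End Speed.

(** * The family of special Lagrangian cones *)

Section ConeTopology.
Context {R : realType} (m : nat).
Hypothesis m_gt0 : (0 < m)%N.
Local Notation X := (cone0 m : set 'rV[R]_(3 + 3)).
Local Notation S := (clink m : set 'rV[R]_(3 + 3)).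

(** The curves of bounded speed also show path connectedness: the link is a union of images of
    segments through one base point. *)
Lemma clink_connected : connected S.
Proof.
have [q y2 y1] := @ellipseP R m m_gt0 1 0 ltac:(by rewrite expr1n expr0n addr0).
have P1 : (1 : R[i]) * conjc 1 = 1 by rewrite conjc1 mulr1.
have := clink_param P1 q y2 y1; set p := param _ _ _ => Sp.
rewrite (_ : S = \bigcup_(A in [set A | [/\ connected A, A p & A `<=` S]]) A).
  apply: bigcup_connected; first by exists p => A [].
  by move=> A [].
apply/seteqP; split=> [x Sx|x [A [_ _ AS] /AS]//].
have [I [c [[Io I01 cs c0 c1] cI]]] := joined_upper_bound m_gt0 Sp.1 Sx.1 Sp.2 Sx.2.
exists (c @` `[0, 1]); last by exists 1 => //=; rewrite in_itv/= ler01 lexx.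
split.
- apply: connected_continuous_connected; first exact: segment_connected.
  apply/subspace_continuousP => t t01; apply: cvg_within_filter.
  exact: (cs 0%N t (I01 t t01)).
- by exists 0 => //=; rewrite in_itv/= ler01 lexx.
- by move=> _ [t /I01/cI[Xct ct1 _] <-].
Qed.

Lemma unit_normalize n (x : 'rV[R]_n) : x != 0 ->
  let r := Num.sqrt (dot x x) in 0 < r /\ dot (r^-1 *: x) (r^-1 *: x) = 1.
Proof.
move=> x0 r; have r0 : 0 < r by rewrite sqrtr_gt0 dot_gt0.
split=> //; rewrite dotZl dotZr -[dot x x]sqr_sqrtr ?dot_ge0// -/r.
by field; rewrite gt_eqF.
Qed.

(** Normalization is continuous away from 0 and sends cone points to the link, which is compact,
    hence closed. So a nonzero limit point normalizes into the link and is a positive multiple of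
    one of its points. *)
Lemma cone0_closed : closed (X `|` [set 0]).
Proof.
move=> x clx; have [->|x0] := eqVneq x 0; [by right|left].
pose f (y : 'rV[R]_(3 + 3)) := (Num.sqrt (dot y y))^-1 *: y.
have [r0 fx1] := unit_normalize x0.
suff Sfx : S (f x).
  have -> : x = Num.sqrt (dot x x) *: f x by rewrite scalerA mulfV ?gt_eqF// scale1r.
  exact: cone0_scale Sfx.1.
pose U : set 'rV[R]_(3 + 3) := [set y | 0 < dot y y].
have dk k (A : set 'rV[R]_(3 + 3)) : open A -> Ck k A (fun y => dot y y).
  by move=> Ao; apply: Ck_dot => //; exact: Ck_id.
have Uo : open U.
  have c y : {for y, continuous (fun y : 'rV[R]_(3 + 3) => dot y y)}.
    exact: (dk 0%N setT openT y Logic.I).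
  by have := @open_comp _ _ _ _ (fun y _ => c y) (@open_gt _ 0).
have Ux : U x by rewrite /U /= dot_gt0.
have fc : Ck 0 U f.
  apply: Ck_rV => // i; apply: (Ck_ext (f := fun y => (Num.sqrt (dot y y))^-1 * y 0 i)) => //.
    by move=> y _; rewrite mxE.
  apply: CkM => //; last by apply: Ck_coord => //; exact: Ck_id.
  apply: CkV => // [y Uy|]; first by rewrite gt_eqF// sqrtr_gt0.
  by apply: Ck_sqrt => //; exact: dk.
have Sc : closed S by apply: compact_closed (clink_compact m_gt0); exact: norm_hausdorff.
apply: Sc => N /(fc x Ux) fN.
have := clx (U `&` f @^-1` N).
have nUN : nbhs x (U `&` f @^-1` N) by apply: filterI => //; exact: open_nbhs_nbhs.
move=> /(_ nUN) [y [Xy [Uy Ny]]]; exists (f y); split=> //.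
have y0 : y != 0 by rewrite -dot_gt0.
have [s0 fy1] := unit_normalize y0.
case: Xy => [Xy|/eqP]; last by rewrite (negbTE y0).
by split=> //; apply: cone0_scale => //; rewrite invr_gt0.
Qed.

Lemma cone_clink : cone S `\ 0 = X.
Proof.
apply/seteqP; split=> [_ [[t [x [t0 [Xx _] ->]]] tx0]|x Xx].
  apply: cone0_scale => //; rewrite lt_neqAle t0 andbT eq_sym.
  by apply/eqP => t00; apply: tx0; rewrite t00 scale0r.
have x0 : x != 0 by apply/eqP => x0; apply: (@cone0_neq0 R m); rewrite -x0.
have [r0 x1] := unit_normalize x0.
split; last exact/eqP.
exists (Num.sqrt (dot x x)), ((Num.sqrt (dot x x))^-1 *: x); split.
- exact: ltW.
- by split=> //; apply: cone0_scale => //; rewrite invr_gt0.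
- by rewrite scalerA mulfV ?gt_eqF// scale1r.
Qed.

Lemma link_cone_clink : link (cone S) = S.
Proof.
apply/seteqP; split=> [_ [[t [x [t0 Sx ->]]] tx1]|x Sx]; last first.
  by split; [exists 1, x; split=> //; rewrite scale1r|exact: Sx.2].
suff -> : t = 1 by rewrite scale1r.
move: tx1; rewrite /unit_sphere /= dotZl dotZr Sx.2 mulr1 -expr2 => /eqP.
by rewrite sqrp_eq1// => /eqP.
Qed.

Lemma clink_special_lagrangian : special_lagrangian_cone (cone S).
Proof.
exists S; split.
  by split; [move=> x []|exact: clink_submanifold|exact: clink_compact].
split; [exact: clink_connected|exact: clink_orientable|by []|].
rewrite cone_clink; apply: ReOmega_calibrated => x E; exact: cone0_frame.
Qed.

End ConeTopology.

(** * The circle action on the link *)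

Section Circle.
Context {R : realType} (m : nat).
Implicit Types (t : R) (E : R[i]) (k : 'I_3).

Definition cis t : R[i] := cos t +i* sin t.

Lemma cisD s t : cis (s + t) = cis s * cis t.
Proof. by apply: complex_eq; rewrite ?cReM ?cImM /= ?cosD ?sinD//; ring. Qed.

Lemma cis_unit t : cis t * conjc (cis t) = 1.
Proof. by apply/mulcJ_eq1; exact: cos2Dsin2. Qed.

Lemma cis0 : cis 0 = 1.
Proof. by rewrite /cis cos0 sin0. Qed.

Lemma cis_int (k : int) : cis (k%:~R * (2 * pi)) = 1.
Proof.
have c2 : cis (2 * pi) = 1 by rewrite /cis mulr_natl cos2pi sin2pi.
have cn (n : nat) : cis (n%:R * (2 * pi)) = 1.
  elim: n => [|n IH]; first by rewrite mul0r cis0.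
  by rewrite -natr1 mulrDl mul1r cisD IH c2 mulr1.
case: k => n; first exact: cn.
rewrite NegzE mulrNz mulNr.
by rewrite -[LHS]mulr1 -{1}(cn n.+1) -cisD addNr cis0.
Qed.

(** After reduction to [s] in [[0, 2 * pi[], the half-angle formula forces sin(s/2) = 0, while the
    sine is positive on the open interval from 0 to [pi]. *)
Lemma cis_eq1 t : cis t = 1 <-> exists k : int, t = k%:~R * (2 * pi).
Proof.
split=> [t1|[k ->]]; last exact: cis_int.
have p0 : 0 < 2 * pi :> R by rewrite mulr_gt0// pi_gt0.
pose k := Num.floor (t / (2 * pi)); exists k.
pose s := t - k%:~R * (2 * pi).
have s1 : cis s = 1.
  have : cis s * cis (k%:~R * (2 * pi)) = 1 by rewrite -cisD subrK.
  by rewrite cis_int mulr1.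
have s0 : 0 <= s by rewrite subr_ge0 -ler_pdivlMr// floor_le.
have s2 : s < 2 * pi.
  rewrite ltrBlDr -[X in X + _]mul1r -mulrDl -ltr_pdivrMr// addrC.
  by have /andP[_] := floor_itv (t / (2 * pi)); rewrite intrD.
suff : s = 0 by move/eqP; rewrite subr_eq0 => /eqP.
apply/eqP; rewrite eq_le s0 andbT leNgt; apply/negP => s_gt0.
have : cos s = 1 by have := congr1 (@complex.Re R) s1.
have -> : s = (s / 2) *+ 2 by rewrite -mulr_natr divfK.
rewrite cos_mulr2n cos2sin2 => c1.
have sp : 0 < sin (s / 2).
  by apply: sin_gt0_pi; apply/andP; split; lra.
have : sin (s / 2) ^+ 2 = 0 by lra.
by move=> /eqP; rewrite sqrf_eq0 gt_eqF.
Qed.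

(** [phase] without the constant ['i], so that it is multiplicative in [E] and has product 1 on the
    unit circle. *)
Definition twist E k : R[i] := [:: E ^+ m; E ^+ m.+1; conjc E ^+ m.*2.+1]`_k.

Definition rot t : 'M[R[i]]_3 := diag_mx (\row_k twist (cis t) k).

Lemma twistM E F k : twist (E * F) k = twist E k * twist F k.
Proof.
move: k; apply: ord3P; rewrite /twist /= ?exprMn//.
by rewrite conjcM exprMn.
Qed.

Lemma twist_phase E F k : twist E k * phase m F k = phase m (E * F) k.
Proof.
move: k; apply: ord3P; rewrite /twist /phase /= ?exprMn//.
by rewrite conjcM exprMn mulrCA.
Qed.

Lemma twist_unit E k : E * conjc E = 1 -> twist E k * conjc (twist E k) = 1.
Proof.
move=> E1; have EX n : E ^+ n * conjc E ^+ n = 1 by rewrite -exprMn E1 expr1n.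
move: k; apply: ord3P; rewrite /twist /= conjcX ?EX//.
by rewrite conjcK mulrC EX.
Qed.

Lemma rot_SU3 t : SU3 (rot t).
Proof.
have t1 k := twist_unit k (cis_unit t).
split.
  apply/unitarymxP; rewrite /rot.
  apply/matrixP => i j; rewrite mul_diag_mx !mxE.
  have [->|ij] := eqVneq j i; last first.
    by rewrite mulr0n conjC0 mulr0.
  by rewrite mulr1n; exact: t1.
rewrite det_diag !big_ord_recl big_ord0 !mxE mulr1.
rewrite /twist /= mulrA -exprD addnS addnn -exprMn cis_unit expr1n//.
Qed.

Lemma rot_circle : circle_subgroup (range rot).
Proof.
exists rot; split=> //.
- move=> i j.
  have [rc ic] : CkC 0 setT (fun t => rot t i j).
    have oT := @openT (R : topologicalType).
    have cc : CkC 0 setT cis.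
      have [c s] := Ck_cos_sin oT (@Ck_id R R 0 setT).
      by split.
    have [ij|ij] := eqVneq i j; last first.
      apply: (CkC_ext (f := fun=> 0)) => //; last exact: CkC_cst.
      by move=> t _; rewrite mxE (negbTE ij) mulr0n.
    apply: (CkC_ext (f := fun t => twist (cis t) j)) => //.
      by move=> t _; rewrite ij [RHS]mxE eqxx mulr1n mxE.
    move: {ij} j; apply: ord3P; rewrite /twist /=.
    - exact: CkCX cc.
    - exact: CkCX cc.
    - by apply: (CkCX (f := fun t => conjc (cis t))) => //; exact: CkCJ cc.
  by split=> t; [exact: (rc t Logic.I)|exact: (ic t Logic.I)].
- move=> s t; rewrite /rot mulmx_diag; congr diag_mx.
  by apply/rowP => k; rewrite !mxE cisD twistM.
- move=> t; rewrite -cis_eq1; split=> [r1|t1].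
    have e k : twist (cis t) k = 1.
      by have := congr1 (fun M : 'M[R[i]]_3 => M k k) r1; rewrite !mxE eqxx mulr1n.
    (* Faithfulness comes from the consecutive weights: the quotient of the two entries is [cis t]
       itself. *)
    have e0 : cis t ^+ m = 1 := e o0; have e1 : cis t ^+ m.+1 = 1 := e o1.
    by move: e1; rewrite exprS e0 mulr1.
  rewrite /rot t1 -[RHS]diag_const_mx; congr diag_mx; apply/rowP => k.
  rewrite [LHS]mxE [RHS]mxE; move: k; apply: ord3P.
  + exact: expr1n.
  + exact: expr1n.
  + by rewrite -[LHS]/(conjc 1 ^+ m.*2.+1) conjc1 expr1n.
- exact: rot_SU3.
Qed.

Lemma rot_act t y E : unitary_act (rot t) (param m y E) = param m y (cis t * E).
Proof.
rewrite /unitary_act /param of_complexK; congr of_complex.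
apply/rowP => k; rewrite mxE mul_diag_mx !mxE -twist_phase; ring.
Qed.

Lemma rot_invariant : invariant_under (range rot) (clink m).
Proof.
move=> _ [t _ <-]; have c1 := cis_unit t.
apply/seteqP; split=> [_ [x [[y [E [E1 q y2 ->]]] x1] <-]|x [[y [E [E1 q y2 xE]]] x1]].
  rewrite rot_act; split.
    exists y, (cis t * E); split=> //.
    by rewrite conjcM mulrACA c1 E1 mulr1.
  move: x1; rewrite /unit_sphere /= !dot_param//.
  by rewrite conjcM mulrACA c1 E1 mulr1.
have E1' : (conjc (cis t) * E) * conjc (conjc (cis t) * E) = 1.
  by rewrite conjcM conjcK mulrACA (mulrC (conjc _)) c1 E1 mulr1.
exists (param m y (conjc (cis t) * E)); last first.
  by rewrite rot_act mulrA c1 mul1r xE.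
split; first by exists y, (conjc (cis t) * E).
by move: x1; rewrite xE /unit_sphere /= (dot_param m y E1) (dot_param m y E1').
Qed.

End Circle.

(** An isometry would let the larger cone inherit the speed [64 * 64 ^ i], which is at most
    [64 ^ j], against the required minimum of twice [64 ^ j]. *)
Lemma cones_not_isometric (R : realType) (i j : nat) : (i < j)%N ->
  forall f g : 'rV[R]_(3 + 3) -> 'rV[R]_(3 + 3),
  ~ isometry (cone0 (64 ^ i)) (cone0 (64 ^ j)) f g.
Proof.
move=> ij f g fg.
have p k : (0 < 64 ^ k)%N by rewrite expn_gt0.
have := isometry_joined_at_speed fg (@cone0_neq0 R _) (@cone0_scale R _)
  (cone0_closed (p i)) (@cone0_neq0 R _) (@cone0_scale R _)
  (cone0_closed (p j)) (joined_upper_bound (p i)).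
move/(joined_lower_bound (p j)); apply/negP; rewrite -ltNge.
have le : 64 * (64 ^ i)%:R <= (64 ^ j)%:R :> R.
  by rewrite -natrM -expnS ler_nat leq_pexp2l.
have g0 : 0 < (64 ^ j)%:R :> R by rewrite ltr0n.
apply: (@le_lt_trans _ _ ((64 ^ j)%:R ^+ 2)).
  by rewrite ler_pXn2r ?nnegrE// mulr_ge0.
by rewrite ltr_pMl ?exprn_gt0// ltr1n.
Qed.

Theorem theorem3 (R : realType) :
  exists C : nat -> set 'rV[R]_(3 + 3),
    (forall i : nat,
       [/\ special_lagrangian_cone (C i),
           link (C i) `<=` unit_sphere,
           embedded_torus (link (C i)) &
           exists G : set 'M[R[i]]_3,
             circle_subgroup G /\ invariant_under G (link (C i))]) /\
    (forall i j : nat, i <> j -> ~ isometric (C i `\ 0) (C j `\ 0)).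
Proof.
have p k : (0 < 64 ^ k)%N by rewrite expn_gt0.
exists (fun i => cone (clink (64 ^ i))); split=> [i|i j ij].
  rewrite link_cone_clink; split.
  - exact: clink_special_lagrangian.
  - by move=> x [].
  - exact: clink_torus.
  - exists (range (rot (64 ^ i))); split; [exact: rot_circle|exact: rot_invariant].
rewrite !cone_clink => -[f [g fg]].
have fgi : isometry (cone0 (64 ^ i)) (cone0 (64 ^ j)) f g := fg.
have [lt|lt|//] := ltngtP i j.
- exact: cones_not_isometric lt _ _ fgi.
- exact: cones_not_isometric lt _ _ (isometry_sym fgi).
Qed.
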